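(* Let $A$ and $H$ be finite abelian groups, let $\Omega$ be a finite $H$-set, and let $G=A\wr_\Omega H$, regarded as a subgroup of the symmetric group $S_m$ (i.e. $G\le S_m$ is a subgroup isomorphic to $A\wr_\Omega H$). Let $V$ be a complex inner product space with $\dim V=n>1$ and a fixed orthonormal basis $\{e_1,\dots,e_n\}$, and let $\chi$ be an irreducible complex character of $G$. If there is $\alpha\in\Gamma_{m,n}$ such that $G_\alpha=\{e\}$ and $|H|\notin\mathbb{N}_0\langle\operatorname{Prime}(|A|)\rangle$, then $V_\chi(G)$ admits an o*-basis if and only if $\chi$ is linear (i.e. $\chi(e)=1$).
   Context: Wreath product: let $K=\prod_{\omega\in\Omega}A_\omega$ be the direct product of copies $A_\omega=A$ indexed by $\Omega$, with componentwise multiplication. $H$ acts on $K$ by automorphisms via $\phi_\Omega(h)(a_\omega)=(a_{h^{-1}\omega})$. Then $A\wr_\Omega H=K\rtimes_{\phi_\Omega}H$, the set $K\times H$ with multiplication $(k_1,h_1)(k_2,h_2)=(k_1\,\phi_\Omega(h_1)(k_2),h_1h_2)$. $\Gamma_{m,n}$ is the set of all sequences $\alpha=(\alpha_1,\dots,\alpha_m)$ of integers with $1\le\alpha_i\le n$. For a subgroup $G\le S_m$, and $\alpha\in\Gamma_{m,n}$, $\alpha\sigma=(\alpha_{\sigma^{-1}(1)},\dots,\alpha_{\sigma^{-1}(m)})$ for $\sigma\in G$, and $G_\alpha=\{\sigma\in G:\alpha\sigma=\alpha\}$ is the stabilizer of $\alpha$; $e$ is the identity of $G$. The tensor power $V^{\otimes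 m}$ carries the induced inner product, for which the tensors $e^\otimes_\alpha=e_{\alpha_1}\otimes\cdots\otimes e_{\alpha_m}$, $\alpha\in\Gamma_{m,n}$, form an orthonormal basis. For $\sigma\in G$, $P_\sigma$ is the linear operator on $V^{\otimes m}$ with $P_\sigma(v_1\otimes\cdots\otimes v_m)=v_{\sigma^{-1}(1)}\otimes\cdots\otimes v_{\sigma^{-1}(m)}$. For an irreducible complex character $\chi$ of $G$, put $$T(G,\chi)=\frac{\chi(e)}{|G|}\sum_{\sigma\in G}\chi(\sigma)P_\sigma .$$ The symmetry class of tensors $V_\chi(G)$ is the image of $T(G,\chi)$ on $V^{\otimes m}$, with the inner product restricted from $V^{\otimes m}$. Write $e^*_\alpha=T(G,\chi)(e^\otimes_\alpha)$ for $\alpha\in\Gamma_{m,n}$. An o*-basis (orthogonal $\ast$-basis) of $V_\chi(G)$ is an orthogonal basis of $V_\chi(G)$ all of whose elements are of the form $e^*_\gamma$ with $\gamma\in\Gamma_{m,n}$. For a positive integer $N$, $\operatorname{Prime}(N)$ is the set of all prime factors of $N$. $\mathbb{N}_0$ is the set of nonnegative integers, and for a finite set of primes $\{p_1,\dots,p_t\}$, $\mathbb{N}_0\langle\{p_1,\dots,p_t\}\rangle=\{k_1p_1+\cdots+k_tp_t: k_i\in\mathbb{N}_0\}$. *)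

(* Defs.v *)
From HB Require Import structures.
From mathcomp Require Import all_boot all_order all_fingroup all_algebra.
From mathcomp Require Import mxrepresentation.
From mathcomp Require Import reals complex.

Set Implicit Arguments.
Unset Strict Implicit.
Unset Printing Implicit Defensive.

Import Order.TTheory GRing.Theory Num.Theory.
Local Open Scope ring_scope.

(* Left H-sets are encoded by the right actions [{action H &-> Omega}] of the *)
(* library, via [to x h = h^-1 . x].                                          *)
Section Wreath.

Local Open Scope group_scope.
Variables (A H : finGroupType) (Omega : finType) (to : {action H &-> Omega}).

Local Notation K := {dffun forall _ : Omega, A}.

Inductive wreath_by (to' : {action H &-> Omega}) : predArgType :=
  Wreath of K * H.

Local Notation W := (wreath_by to).

Definition wreath_val (u : W) : K * H := let: Wreath kh := u in kh.

HB.instance Definition _ := [isNew for wreath_val].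
HB.instance Definition _ := [Finite of W by <:].

Definition wreath_phi (h : H) (k : K) : K := [ffun x => k (to x h)].

Definition wreath_one : W := Wreath to (1, 1).
Definition wreath_mul (u v : W) : W :=
  let: Wreath (k1, h1) := u in let: Wreath (k2, h2) := v in
  Wreath to (k1 * wreath_phi h1 k2, h1 * h2).
Definition wreath_inv (u : W) : W :=
  let: Wreath (k, h) := u in Wreath to (wreath_phi h^-1 k^-1, h^-1).

Lemma wreath_phi1 k : wreath_phi 1 k = k.
Proof. by apply/ffunP => x; rewrite ffunE act1. Qed.

Lemma wreath_phiM h1 h2 k :
  wreath_phi h1 (wreath_phi h2 k) = wreath_phi (h1 * h2) k.
Proof. by apply/ffunP => x; rewrite !ffunE actM. Qed.

Lemma wreath_phi_morph h : {morph wreath_phi h : k1 k2 / k1 * k2}.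
Proof. by move=> k1 k2; apply/ffunP => x; rewrite !(mulg_ffun, ffunE). Qed.

Fact wreath_mulA : associative wreath_mul.
Proof.
move=> [[k1 h1]] [[k2 h2]] [[k3 h3]] /=.
by rewrite wreath_phi_morph wreath_phiM !mulgA.
Qed.

Fact wreath_mul1 : left_id wreath_one wreath_mul.
Proof. by case=> [[k h]] /=; rewrite wreath_phi1 !mul1g. Qed.

Fact wreath_mulV : left_inverse wreath_one wreath_inv wreath_mul.
Proof.
case=> [[k h]] /=; rewrite -wreath_phi_morph !mulVg.
by congr (Wreath _ (_, _)); apply/ffunP => x; rewrite ffunE !oneg_ffun.
Qed.

HB.instance Definition _ :=
  Finite_isGroup.Build W wreath_mulA wreath_mul1 wreath_mulV.

End Wreath.

Notation wreath A to := (@wreath_by A _ _ to).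

Section Gamma.

Variables m n : nat.

Definition Gamma := {ffun 'I_m -> 'I_n}.

Definition gact (a : Gamma) (s : 'S_m) : Gamma := [ffun i => a ((s^-1)%g i)].

Definition gstab (G : {set 'S_m}) (a : Gamma) : {set 'S_m} :=
  [set s in G | gact a s == a].

End Gamma.

(* [chi] is an irreducible character of [G] over [C]; only its values on [G]  *)
(* matter.  Composition in ['S_m] is left-to-right, but the transpose of a    *)
(* representation has the same trace, so the irreducible characters do not    *)
(* depend on the order of composition.                                        *)
Definition is_irr_char (C : fieldType) (gT : finGroupType) (G : {group gT})
    (chi : gT -> C) :=
  exists (d : nat) (rG : mx_representation C G d),
    mx_irreducible rG /\ {in G, forall x, chi x = \tr (rG x)}.

(* The [m]-th tensor power of an [n]-dimensional space with orthonormal basis *)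
(* [e], in coordinates: [t a] is the coefficient of [t] on                    *)
(* [e_(a 0) (x) ... (x) e_(a (m - 1))].  The lemmas [etensE], [pure_linear],   *)
(* [tdot_pure] and [Pop_pure] below relate this model to pure tensors.        *)
Notation tpow C m n := {ffun Gamma m n -> C^o}.

Section InnerProduct.

Variables (C : numClosedFieldType) (m n : nat).
Local Notation T := (tpow C m n).

Definition tdot (t u : T) : C := \sum_a t a * (u a)^*.

Fact tdot_bilinear :
  bilinear_for (GRing.Scale.Law.clone _ _ *%R _)
    (GRing.Scale.Law.clone _ _ (Num.conj \; *%R) _) tdot.
Proof.
split=> u c t1 t2 /=; rewrite /tdot mulr_sumr -big_split /=.
  by apply: eq_bigr => a _; rewrite !ffunE mulrDl mulrA.
apply: eq_bigr => a _.
by rewrite !ffunE rmorphD rmorphM mulrDr /= mulrCA.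
Qed.

HB.instance Definition _ :=
  bilinear_isBilinear.Build C T T C _ _ tdot tdot_bilinear.

Fact tdot_herm t u : tdot t u = (-1) ^+ false * (tdot u t)^*.
Proof.
rewrite expr0 mul1r /tdot rmorph_sum.
by apply: eq_bigr => a _; rewrite rmorphM /= conjCK mulrC.
Qed.

HB.instance Definition _ :=
  isHermitianSesquilinear.Build C T false Num.conj tdot tdot_herm.

Fact tdot_gt0 (t : T) : t != 0 -> 0 < tdot t t.
Proof.
move=> t0; rewrite lt_def sumr_ge0 ?andbT => [|a _]; last exact: mul_conjC_ge0.
apply: contra t0 => /eqP tt0; apply/eqP/ffunP => a; rewrite ffunE.
apply/eqP; rewrite -mul_conjC_eq0.
have /psumr_eq0P := tt0.
by move=> -> // b _; exact: mul_conjC_ge0.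
Qed.

HB.instance Definition _ := isDotProduct.Build C T tdot tdot_gt0.

End InnerProduct.

Section PureTensors.

Variables (C : numClosedFieldType) (m n : nat).
Variables (V : vectType C) (e : n.-tuple V).

Definition pure (v : 'I_m -> V) : tpow C m n :=
  [ffun a : Gamma m n => \prod_i coord e (a i) (v i)].

Definition etens (a : Gamma m n) : tpow C m n := pure (fun i => tnth e (a i)).

Lemma etensE (a b : Gamma m n) : free e -> etens a b = (a == b)%:R.
Proof.
move=> fe; rewrite /etens /pure ffunE; have [<-|ab] := eqVneq a b.
  by rewrite big1 // => i _; rewrite (tnth_nth 0) coord_free // eqxx.
have /existsP[i abi] : [exists i, a i != b i].
  apply: contraR ab; rewrite negb_exists => /forallP ab.
  by apply/eqP/ffunP => i; apply/eqP; have := ab i; rewrite negbK.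
rewrite (bigD1 i) //= (tnth_nth 0) coord_free //.
by rewrite (negPf abi) mul0r.
Qed.

Lemma pure_linear (v : 'I_m -> V) (j : 'I_m) (c : C) (x y : V) :
  pure (fun i => if i == j then c *: x + y else v i) =
  c *: pure (fun i => if i == j then x else v i)
    + pure (fun i => if i == j then y else v i).
Proof.
apply/ffunP => a; rewrite !ffunE !(bigD1 (P := xpredT) j) //= !eqxx.
rewrite linearP /= mulrDl -mulrA; congr (c * (_ * _) + _ * _).
  by apply: eq_bigr => i /negPf->.
by apply: eq_bigr => i /negPf->.
Qed.

Lemma tdot_pure (dot : {dot V for Num.conj}) (v w : 'I_m -> V) :
  basis_of fullv e -> orthonormal dot e ->
  tdot (pure v) (pure w) = \prod_i dot (v i) (w i).
Proof.
move=> be oe.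
have dote (i j : 'I_n) : dot e`_i e`_j = (i == j)%:R.
  have [uniq_e oe'] := orthonormalP oe.
  by rewrite oe' ?mem_nth ?size_tuple // nth_uniq ?size_tuple.
have dotE (x y : V) : dot x y = \sum_j coord e j x * (coord e j y)^*.
  rewrite {1}(coord_basis be (memvf x)) {1}(coord_basis be (memvf y)).
  rewrite linear_sumlz; apply: eq_bigr => j _; rewrite linearZl_LR /=.
  congr (_ * _); rewrite linear_sumr /= (bigD1 j) //= linearZr_LR /= dote eqxx mulr1.
  rewrite big1 ?addr0 // => k kj.
  by rewrite linearZr_LR /= dote eq_sym (negPf kj) mulr0.
rewrite /tdot (eq_bigr _ (fun i _ => dotE (v i) (w i))) bigA_distr_bigA /=.
apply: eq_bigr => a _; rewrite !ffunE rmorph_prod -big_split /=.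
by apply: eq_bigr.
Qed.

End PureTensors.

Section Symmetrizer.

Variables (C : numClosedFieldType) (m n : nat).
Local Notation T := (tpow C m n).

Definition perm_tensor (s : 'S_m) (t : T) : T :=
  [ffun a => t (gact a (s^-1)%g)].

Fact perm_tensor_linear s : linear (perm_tensor s).
Proof. by move=> c t u; apply/ffunP => a; rewrite !ffunE. Qed.

HB.instance Definition _ s :=
  GRing.isLinear.Build C T T _ (perm_tensor s) (perm_tensor_linear s).

Definition Pop (s : 'S_m) : 'End(T) := linfun (perm_tensor s).

Lemma Pop_pure (V : vectType C) (e : n.-tuple V) s (v : 'I_m -> V) :
  Pop s (pure e v) = pure e (fun i => v ((s^-1)%g i)).
Proof.
rewrite lfunE; apply/ffunP => a; rewrite !ffunE /=.
rewrite (reindex_inj (@perm_inj _ (s^-1)%g)) /=.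
by apply: eq_bigr => i _; rewrite ffunE invgK permKV.
Qed.

Definition Tsym (G : {set 'S_m}) (chi : 'S_m -> C) : 'End(T) :=
  (chi 1%g / #|G|%:R) *: \sum_(s in G) chi s *: Pop s.

Definition sym_class (G : {set 'S_m}) (chi : 'S_m -> C) : {vspace T} :=
  limg (Tsym G chi).

Definition estar (V : vectType C) (e : n.-tuple V) (G : {set 'S_m})
    (chi : 'S_m -> C) (a : Gamma m n) : T :=
  Tsym G chi (etens e a).

Definition ostar_basis (V : vectType C) (e : n.-tuple V) (G : {set 'S_m})
    (chi : 'S_m -> C) (X : seq T) :=
  [/\ basis_of (sym_class G chi) X,
      pairwise_orthogonal (@tdot C m n) X &
      {in X, forall x, exists a, x = estar e G chi a}].

End Symmetrizer.

(* The set N_0<ps> of the combinations of [ps] with coefficients in N_0.      *)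
Definition nat_span (ps : seq nat) (N : nat) :=
  exists k : nat -> nat, N = (\sum_(p <- ps) k p * p)%N.

(* Main.v *)
Require Import Defs.
From mathcomp Require Import all_boot all_order all_fingroup all_algebra.
From mathcomp Require Import mxrepresentation.
From mathcomp Require Import reals complex.
From mathcomp Require Import separable algC cyclotomic algnum cyclic spectral zify ring.

Set Implicit Arguments.
Unset Strict Implicit.
Unset Printing Implicit Defensive.

Import Order.TTheory GRing.Theory Num.Theory.
Local Open Scope ring_scope.

(* Write [G = K H] with [K = A^Omega] normal abelian and [H] abelian.  If     *)
(* [chi] is linear, the [e*_a] along one orbit are collinear, so one nonzero  *)
(* [e*_a] per orbit gives an o*-basis.                                        *)
(*                                                                            *)
(* Conversely let [d = chi(1) > 1] and suppose there is an o*-basis [X].  The *)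
(* [H]-translates of a weight vector of [K] show that [d] divides [#|H|],     *)
(* that [chi k] is a sum of [d] [#|A|]-th roots of unity for [k] in [K], and  *)
(* that each [h] in [H] either acts as a scalar or satisfies [chi = 0] on     *)
(* [K h].  On the regular orbit of [alpha], the inner product of              *)
(* [e*_(alpha u)] and [e*_(alpha w)] is a nonzero multiple of [chi(u^-1 w)].  *)
(* If [chi] had no zero on [K], a single element of [X] would fail to be      *)
(* orthogonal to the [e*_(alpha k)], [k] in [K]; these would be collinear,    *)
(* [K] would act by scalars, and [d = 1].  So [chi k = 0] for some [k], and   *)
(* the Lam-Leung theorem (a vanishing sum of [d] [n]-th roots of unity forces *)
(* [d] into [N_0<primes n>]) puts [d], hence [#|H|], in [N_0<primes #|A|>].   *)
(*                                                                            *)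
(* For Lam-Leung, let [q < p2] be the two smallest primes dividing [n].  Any  *)
(* [d >= (q - 1) (p2 - 1)] lies in [N_0<q, p2>].  A shorter vanishing sum is  *)
(* even a disjoint union of cosets of subgroups of prime order: adjoining one *)
(* prime at a time, its slices along the new prime have equal sums, and       *)
(* brevity forces the lightest slice to be contained in every other one.      *)

(** * Vanishing sums of roots of unity *)

(** The argument rests on [abelian_product_char], [ostar_basis_char_zero] and [lam_leung]. The
    weights of [K] in an irreducible module form one [H]-orbit. By Schur's lemma and commutativity
    of [H], the stabilizer of a weight in [H] is the subgroup acting by scalars, so one translate
    per coset of it gives a basis of weight vectors. An [h] outside it moves every weight line,
    which makes the trace vanish on [K h]. Hence wherever [chi x] is nonzero, [rG x] is a multiple
    of some [rG k]. If [chi] also had no zero on [K], non-orthogonality along the regular orbit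
    would be transitive, which an orthogonal basis tolerates only for [d = 1].

    Vanishing sums are studied in [algC], where automorphisms acting on roots of unity are
    available, and are carried to [C] through the cyclotomic polynomial. *)

Definition fixes_roots (m : nat) (u : algC -> algC) :=
  forall z, z ^+ m = 1 -> u z = z.

(** By Galois theory this is membership in the field generated by the [m]-th roots of unity, in the
    form needed to conjugate a linear relation. *)
Definition in_cyclotomic_field (m : nat) (a : algC) :=
  forall u : {rmorphism algC -> algC}, fixes_roots m u -> u a = a.

(** As [p] divides [m], adjoining [z] to the field of [m]-th roots of unity is an extension of
    degree [p], so the first [p] powers of [z] are independent over it. *)
Lemma prim_root_sum_eq0_dvd m p (z : algC) (a : 'I_p -> algC) :
    prime p -> (p %| m)%N -> (p * m)%N.-primitive_root z ->
    (forall j, in_cyclotomic_field m (a j)) ->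
  \sum_j a j * z ^+ j = 0 -> forall j, a j = 0.
Proof.
move=> pr_p p_dv_m prim_z fix_a sum0 j0.
have p_gt0 := prime_gt0 pr_p.
have pm_gt0 := prim_order_gt0 prim_z.
have m_gt0 : (0 < m)%N by move: pm_gt0; rewrite muln_gt0 => /andP[].
have prim_t : p.-primitive_root (z ^+ m).
  rewrite -[X in z ^+ X](mulKn m p_gt0).
  by apply: (dvdn_prim_root prim_z); rewrite dvdn_mulr.
(* The powers of [z] are absorbed into the coefficients: conjugating by [z -> z ^+ (1 + m * l)]
   makes [z ^+ m ^+ l] a root, and [p] distinct roots exceed the degree. *)
pose P := \poly_(j < p) (if insub j is Some j' then a j' * z ^+ j else 0).
have rootP (l : 'I_p) : root P (z ^+ m ^+ l).
  have co : coprime (1 + m * l)%N (p * m)%N.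
    rewrite coprimeMr; apply/andP; split; last first.
      by rewrite coprime_sym /coprime addnC mulnC gcdnMDl gcdn1.
    have [c ->] := dvdnP p_dv_m.
    by rewrite coprime_sym /coprime addnC mulnAC gcdnMDl gcdn1.
  have [u uE] := Qn_aut_exists co.
  have fix_u : fixes_roots m u.
    move=> y y1; rewrite uE; last by rewrite mulnC exprM y1 expr1n.
    by rewrite exprD expr1 exprM y1 expr1n mulr1.
  have := congr1 u sum0; rewrite rmorph0 rmorph_sum /= => sum1.
  rewrite /root /P horner_poly -[X in _ == X]sum1; apply/eqP/eq_bigr => j _.
  rewrite valK rmorphM rmorphXn /= fix_a // uE ?(prim_expr_order prim_z) //.
  rewrite -mulrA; congr (_ * _).
  by rewrite exprD expr1 exprMn -!exprM; congr (_ * z ^+ _); rewrite mulnA.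
have P0 : P = 0.
  apply: (@roots_geq_poly_eq0 _ _ [seq z ^+ m ^+ (l : 'I_p) | l <- enum 'I_p]).
  - by apply/allP => _ /mapP[l _ ->].
  - rewrite map_inj_uniq ?enum_uniq // => l1 l2 /eqP.
    by rewrite (eq_prim_root_expr prim_t) !modn_small // => /eqP/val_inj.
  by rewrite size_map size_enum_ord size_poly.
have := congr1 (fun Q : {poly algC} => Q`_j0) P0.
rewrite coef0 coef_poly ltn_ord valK => /eqP; rewrite mulf_eq0 expf_eq0.
case/orP=> [/eqP //|/andP[_ /eqP z0]].
by have /eqP := prim_expr_order prim_z; rewrite z0 expr0n eqn0Ngt pm_gt0 eq_sym oner_eq0.
Qed.

(** For [p] prime to [m], the polynomial [1 + X + ... + X^(p-1)] stays irreducible over the field of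
    [m]-th roots of unity, so it gives the only relation among the powers of [w]. *)
Lemma prim_root_sum_eq0_coprime m p (w : algC) (a : 'I_p -> algC) :
    prime p -> (0 < m)%N -> coprime p m -> p.-primitive_root w ->
    (forall j, in_cyclotomic_field m (a j)) ->
  \sum_j a j * w ^+ j = 0 -> forall j1 j2, a j1 = a j2.
Proof.
case: p a => // p a pr_p m_gt0 co_p_m prim_w fix_a sum0.
suff last j : a j = a ord_max by move=> j1 j2; rewrite !last.
(* The prime is now [p.+1]. Subtracting the last coefficient, as the geometric sum allows, leaves
   size at most [p], against the [p] roots [w ^+ l] with [l != 0]. *)
pose P := \poly_(j < p) (a (inord j) - a ord_max).
have rootP (l : 'I_p.+1) : l != 0 :> nat -> root P (w ^+ l).
  move=> l0.
  (* The exponent is [l] modulo the prime and 1 modulo [m]: the automorphism sends [w] to [w ^+ l]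
     and fixes the coefficients. *)
  pose k := chinese p.+1 m l 1.
  have kp : k = l %[mod p.+1] := chinese_modl co_p_m l 1.
  have km : k = 1 %[mod m] := chinese_modr co_p_m l 1.
  have co : coprime k (p.+1 * m)%N.
    rewrite coprimeMr -coprime_modl kp coprime_modl -[coprime k m]coprime_modl km.
    rewrite coprime_modl coprime1n andbT coprime_sym prime_coprime //.
    by rewrite gtnNdvd ?lt0n.
  have [u uE] := Qn_aut_exists co.
  have fix_u : fixes_roots m u.
    move=> y y1; rewrite uE; last by rewrite mulnC exprM y1 expr1n.
    by rewrite -(expr_mod k y1) km (expr_mod 1 y1).
  have uw : u w = w ^+ l.
    rewrite uE; last by rewrite exprM (prim_expr_order prim_w) expr1n.
    by rewrite -(prim_expr_mod prim_w k) kp (prim_expr_mod prim_w).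
  have wl1 : w ^+ l != 1.
    rewrite -(prim_order_dvd prim_w) gtnNdvd ?lt0n //.
  have geo : \sum_(j < p.+1) (w ^+ l) ^+ j = 0.
    apply/eqP; have := subrX1 (w ^+ l) p.+1.
    rewrite -exprM mulnC exprM (prim_expr_order prim_w) expr1n subrr => /esym/eqP.
    by rewrite mulf_eq0 subr_eq0 (negPf wl1).
  have := congr1 u sum0; rewrite rmorph0 rmorph_sum /=.
  under eq_bigr => i _ do rewrite rmorphM rmorphXn /= uw fix_a //.
  rewrite /root /P horner_poly => sum1; apply/eqP.
  transitivity (\sum_(j < p.+1) (a j - a ord_max) * (w ^+ l) ^+ j).
    rewrite [RHS]big_ord_recr /= subrr mul0r addr0; apply: eq_bigr => i _.
    congr ((a _ - _) * _); apply: val_inj => /=; rewrite inordK //.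
    exact: (leq_trans (ltn_ord i)).
  under eq_bigr => i _ do rewrite mulrBl.
  by rewrite sumrB sum1 -mulr_sumr geo mulr0 subrr.
have P0 : P = 0.
  apply: (@roots_geq_poly_eq0 _ _ [seq w ^+ l.+1 | l <- iota 0 p]).
  - apply/allP => x /mapP[l]; rewrite mem_iota add0n => /andP[_ lp] ->.
    by have := rootP (inord l.+1); rewrite inordK //; apply.
  - rewrite map_inj_in_uniq ?iota_uniq // => l1 l2.
    rewrite !mem_iota !add0n => /andP[_ lp1] /andP[_ lp2] /eqP.
    by rewrite (eq_prim_root_expr prim_w) !modn_small // => /eqP[].
  by rewrite size_map size_iota size_poly.
have [jp|jp] := ltnP j p; last first.
  by congr a; apply: val_inj => /=; apply/eqP; rewrite eqn_leq jp -ltnS ltn_ord.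
have := congr1 (fun Q : {poly algC} => Q`_j) P0.
by rewrite coef0 coef_poly jp inord_val => /eqP; rewrite subr_eq0 => /eqP.
Qed.

Lemma nat_span0 ps : nat_span ps 0.
Proof. by exists (fun=> 0%N); rewrite big1. Qed.

Lemma nat_spanD ps a b : nat_span ps a -> nat_span ps b -> nat_span ps (a + b).
Proof.
move=> [k ->] [l ->]; exists (fun p => k p + l p)%N.
by rewrite -big_split; apply: eq_bigr => p _; rewrite mulnDl.
Qed.

Lemma nat_span_sum (I : finType) ps (F : I -> nat) :
  (forall i, nat_span ps (F i)) -> nat_span ps (\sum_i F i).
Proof.
by move=> spanF; elim/big_ind: _ => //; [exact: nat_span0 | exact: nat_spanD].
Qed.

Lemma nat_spanMl ps a b : nat_span ps a -> nat_span ps (b * a).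
Proof.
move=> [k ->]; exists (fun p => b * k p)%N; rewrite big_distrr.
by apply: eq_bigr => p _; exact: mulnA.
Qed.

Lemma nat_span_mem ps p : uniq ps -> p \in ps -> nat_span ps p.
Proof.
move=> ups psp; exists (fun r => r == p).
rewrite (bigD1_seq p) //= eqxx mul1n big1 ?addn0 // => r /negPf->.
by rewrite mul0n.
Qed.

(** The Frobenius coin bound: with [c] the residue of [N / a] modulo [b], having [c * a > N] would
    force [N <= (b - 1) * a - b], one less than [(a - 1) * (b - 1)]. *)
Lemma nat_span_large ps a b N :
    uniq ps -> a \in ps -> b \in ps -> coprime a b -> (0 < b)%N ->
  ((a - 1) * (b - 1) <= N)%N -> nat_span ps N.
Proof.
move=> ups aps bps co_ab b_gt0 leN.
have [c [c_lt cN]] : exists c, (c < b)%N /\ c * a = N %[mod b].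
  exists (chinese a b 0 N %/ a %% b)%N; split; first by rewrite ltn_mod.
  rewrite modnMml divnK ?(chinese_modr co_ab) //.
  by apply/eqP; rewrite (chinese_modl co_ab) mod0n.
have leM : (c * a <= N)%N.
  rewrite leqNgt; apply/negP => ltM.
  have /eqP := cN; rewrite eqn_mod_dvd ?(ltnW ltM) // => /dvdnP[[|k] kE].
    by move: ltM; rewrite -subn_gt0 kE.
  have leca : (c * a <= (b - 1) * a)%N by rewrite leq_mul2r; apply/orP; right; lia.
  have a_gt0 : (0 < a)%N by case: (a) ltM => //; rewrite muln0.
  have leb : (b <= k.+1 * b)%N by rewrite leq_pmull.
  move: leN leca kE leb ltM; case: (a) a_gt0 => // a' _; case: (b) b_gt0 => // b' _.
  by rewrite !subn1 /= !mulnS; lia.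
have /eqP := esym cN; rewrite eqn_mod_dvd // => /dvdnP[k kE].
have -> : N = (c * a + k * b)%N by lia.
by apply: nat_spanD; apply: nat_spanMl; apply: nat_span_mem.
Qed.

(** * Decomposition of short vanishing sums, one prime at a time *)

Section LamLeung.

Variables (ps : seq nat) (q p2 : nat) (eta : algC).
Hypotheses (uniq_ps : uniq ps) (pr_q : prime q) (q_lt : (q < p2)%N).
Hypothesis (prim_eta : q.-primitive_root eta).

(* Coordinates [(i, t)] parametrize the roots of unity [eta ^+ i * w t]; a    *)
(* weight [f i t] splits into full [eta]-cosets [c t] and, inside each slice  *)
(* [i], a sum [g i] of cosets of subgroups of other prime orders ([dec]).     *)
Record root_system (m : nat) (T : finType) (w : T -> algC)
    (dec : (T -> nat) -> Prop) : Prop := RootSystem {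
  rs_root t : w t ^+ m = 1;
  rs_cover z : z ^+ m = 1 -> exists (i : 'I_q) t, z = eta ^+ i * w t;
  rs_span g : dec g -> nat_span ps (\sum_t g t);
  rs_bound g t : dec g -> (p2 * g t <= \sum_t' g t')%N;
  rs_dec (f : 'I_q -> T -> nat) :
    \sum_i \sum_t (f i t)%:R * (eta ^+ i * w t) = 0 ->
    (\sum_i \sum_t f i t < (q - 1) * (p2 - 1))%N ->
    exists (c : T -> nat) (g : 'I_q -> T -> nat),
      (forall i, dec (g i)) /\ forall i t, f i t = (c t + g i t)%N
}.

(** A vanishing sum of [q]-th roots of unity has constant weights, so it consists of full
    [eta]-cosets with nothing left over. *)
Lemma root_system_base :
  root_system q (fun=> 1 : algC) (fun g : unit -> nat => forall t, g t = 0%N).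
Proof.
have q_gt0 := prime_gt0 pr_q.
split=> [t||g g0|g t g0|f sum0 _].
- by rewrite expr1n.
- by move=> z /(prim_rootP prim_eta)[i ->]; exists i, tt; rewrite mulr1.
- by rewrite big1 //; exact: nat_span0.
- by rewrite g0 muln0.
pose i0 : 'I_q := Ordinal q_gt0.
exists (f i0), (fun _ _ => 0%N); split=> // i []; rewrite addn0.
have co_q1 : coprime q 1 by rewrite coprimen1.
apply/eqP; rewrite -(eqr_nat algC); apply/eqP; move: i i0.
apply: (prim_root_sum_eq0_coprime pr_q _ co_q1 prim_eta (a := fun i => (f i tt)%:R)) => //.
  by move=> i u _; rewrite rmorph_nat.
rewrite -[RHS]sum0; apply: eq_bigr => i _.
by rewrite (big_pred1 tt) ?mulr1 //; case.
Qed.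

Lemma in_cyclotomic_sum m (T : finType) (w : T -> algC) (f : 'I_q -> T -> nat) :
    (q %| m)%N -> (forall t, w t ^+ m = 1) ->
  in_cyclotomic_field m (\sum_i \sum_t (f i t)%:R * (eta ^+ i * w t)).
Proof.
move=> q_dv_m wm u fix_u; rewrite rmorph_sum; apply: eq_bigr => i _.
rewrite rmorph_sum; apply: eq_bigr => t _; rewrite rmorphM rmorph_nat fix_u //.
have /eqP eta_m : eta ^+ m == 1 by rewrite -(prim_order_dvd prim_eta).
by rewrite exprMn exprAC eta_m expr1n mul1r wm.
Qed.

(** All slices along the powers of [z] vanish separately, so each is decomposed by itself. *)
Lemma root_system_dvd p m (T : finType) (w : T -> algC) dec :
    prime p -> (p %| m)%N -> (q %| m)%N -> (0 < m)%N -> root_system m w dec ->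
  exists (T' : finType) w' dec', @root_system (p * m)%N T' w' dec'.
Proof.
move=> pr_p p_dv_m q_dv_m m_gt0 sysT.
have p_gt0 := prime_gt0 pr_p.
have [z prim_z] : {z : algC | (p * m)%N.-primitive_root z}.
  by apply: C_prim_root_exists; rewrite muln_gt0 p_gt0.
have prim_zp : m.-primitive_root (z ^+ p).
  rewrite -[X in z ^+ X](mulnK p m_gt0).
  by apply: (dvdn_prim_root prim_z); rewrite dvdn_mull.
exists (T * 'I_p)%type, (fun x : T * 'I_p => w x.1 * z ^+ x.2).
exists (fun g : T * 'I_p -> nat => forall j, dec (fun t => g (t, j))).
have sumE (g : T * 'I_p -> nat) : (\sum_x g x = \sum_(j < p) \sum_(t : T) g (t, j))%N.
  by rewrite exchange_big pair_bigA; apply: eq_bigr => -[].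
split=> [[t j]|y y1|g dec_g|g [t j] dec_g|f sum0 lt_f].
- rewrite exprMn mulnC exprM (rs_root sysT) expr1n mul1r exprAC mulnC.
  by rewrite (prim_expr_order prim_z) expr1n.
- have [a ->] := prim_rootP prim_z y1.
  have /(rs_cover sysT)[i [t itE]] : (z ^+ p ^+ (a %/ p)) ^+ m = 1.
    by rewrite exprAC (prim_expr_order prim_zp) expr1n.
  exists i, (t, Ordinal (ltn_pmod a p_gt0)) => /=.
  by rewrite mulrA -itE -exprM -exprD {1}(divn_eq a p) [(_ %/ _ * p)%N]mulnC.
- by rewrite sumE; apply: nat_span_sum => j; apply: (rs_span sysT); apply: dec_g.
- rewrite sumE (bigD1 j) //=.
  by apply: leq_trans (leq_addr _ _); apply: (rs_bound sysT (g := fun t => g (t, j))); apply: dec_g.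
have sum_j0 : forall j, \sum_i \sum_t (f i (t, j))%:R * (eta ^+ i * w t) = 0.
  apply: (prim_root_sum_eq0_dvd pr_p p_dv_m prim_z).
    by move=> j; apply: in_cyclotomic_sum => //; apply: rs_root sysT.
  rewrite -[RHS]sum0.
  under eq_bigr => j _ do rewrite mulr_suml.
  rewrite exchange_big; apply: eq_bigr => i _ /=.
  under eq_bigr => j _ do rewrite mulr_suml.
  rewrite exchange_big pair_bigA; apply: eq_bigr => -[t j] _ /=.
  by rewrite !mulrA.
have lt_j j : (\sum_i \sum_t f i (t, j) < (q - 1) * (p2 - 1))%N.
  apply: leq_ltn_trans lt_f; apply: leq_sum => i _.
  by rewrite sumE (bigD1 j) //= leq_addr.
have /fin_all_exists[c /fin_all_exists[g cgP]] j := rs_dec sysT (sum_j0 j) (lt_j j).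
exists (fun x => c x.2 x.1), (fun i x => g x.2 i x.1); split.
  by move=> i j; case: (cgP j) => dec_g _; apply: dec_g.
by move=> i [t j]; case: (cgP j) => _ ->.
Qed.

(* For [y] as in [root_system_coprime]: over a point [t], [s] is the mass of  *)
(* the lightest slice, [c] the number of full [eta]-cosets in [y] and [G] the *)
(* mass of the rest of [y]; [t0], [L], [l] are the total masses of the        *)
(* lightest slice, of [y] and of the whole sum.                               *)
Lemma fiber_count_bound p c G L s t0 l :
    (p2 <= p)%N -> (s <= t0)%N -> (q * s <= q * c + G + s)%N ->
    (q * c + p2 * G <= L)%N -> (L + (p - q) * t0 <= l)%N ->
    (l < (q - 1) * (p2 - 1))%N ->
  (s <= c)%N.
Proof.
move=> le_p le_s leG leL le_l lt_l; rewrite leqNgt; apply/negP => lt_c.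
(* With [s = c + v] and [v > 0], the hypotheses add up to [l >= q c + p2 G + (p2 - q) s >= q v (p2 -
   1)], against the bound on [l]. *)
have [v v_gt0 sE] : exists2 v, (0 < v)%N & s = (c + v)%N.
  by exists (s - c)%N; lia.
have [k pE] : exists k, p = (q + k)%N by exists (p - q)%N; lia.
have [e p2E] : exists e, p2 = (q + e)%N by exists (p2 - q)%N; lia.
have le1 : (e * s <= (p - q) * t0)%N by apply: leq_mul => //; lia.
have le2 : (p2 * (q * v) <= p2 * G + p2 * s)%N.
  by rewrite -mulnDr leq_mul2l; apply/orP; right; lia.
have le3 : (q * (p2 - 1) <= v * (q * (p2 - 1)))%N by rewrite leq_pmull.
have le4 : ((q - 1) * (p2 - 1) <= q * (p2 - 1))%N by rewrite leq_mul2r; lia.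
have E1 : (p2 * s = q * s + e * s)%N by rewrite p2E mulnDl.
have E2 : (v * (q * (p2 - 1)) + q * v = p2 * (q * v))%N.
  have -> : p2 = (p2 - 1).+1 by lia.
  by rewrite subn1 /=; ring.
have E3 : (q * s = q * c + q * v)%N by rewrite sE mulnDr.
lia.
Qed.

Lemma sum_prim_root : \sum_(i < q) eta ^+ i = 0.
Proof.
have := subrX1 eta q; rewrite (prim_expr_order prim_eta) subrr => /esym/eqP.
rewrite mulf_eq0 subr_eq0 => /orP[eta1|/eqP //].
have := prim_order_dvd prim_eta 1; rewrite expr1 eta1 dvdn1 => /eqP q1.
by move: pr_q; rewrite q1.
Qed.

Lemma root_coprime_split p m (z : algC) :
    coprime p m -> z ^+ (p * m) = 1 ->
  exists x y, [/\ z = x * y, x ^+ m = 1 & y ^+ p = 1].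
Proof.
move=> co z1; exists (z ^+ chinese p m 0 1), (z ^+ chinese p m 1 0); split.
- rewrite -exprD -[LHS]expr1 -(expr_mod _ z1) -[RHS](expr_mod _ z1).
  congr (z ^+ _); apply/eqP; rewrite (chinese_remainder co).
  by rewrite -!(modnDm _ (chinese p m 1 0)) !(chinese_modl co) !(chinese_modr co) !modnDm !eqxx.
- have /dvdnP[k ->] : (p %| chinese p m 0 1)%N.
    by rewrite /dvdn (chinese_modl co) mod0n.
  by rewrite -exprM -mulnA mulnC exprM z1 expr1n.
have /dvdnP[k ->] : (m %| chinese p m 1 0)%N.
  by rewrite /dvdn (chinese_modr co) mod0n.
by rewrite -exprM -mulnA [(m * p)%N]mulnC mulnC exprM z1 expr1n.
Qed.

(** Once the lightest slice is contained in every other, repeating it along all [j] gives full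
    cosets of order [p] (the part [C]), and the rest of each slice is made of [eta]-cosets and a
    part of the old type. *)
Lemma root_system_coprime p m (T : finType) (w : T -> algC) dec :
    prime p -> p \in ps -> coprime p m -> (p2 <= p)%N -> (q %| m)%N ->
    (0 < m)%N -> root_system m w dec ->
  exists (T' : finType) w' dec', @root_system (p * m)%N T' w' dec'.
Proof.
move=> pr_p ps_p co_pm le_p2p q_dv_m m_gt0 sysT.
have p_gt0 := prime_gt0 pr_p.
have [z prim_z] := C_prim_root_exists p_gt0.
exists (T * 'I_p)%type, (fun x : T * 'I_p => w x.1 * z ^+ x.2).
exists (fun g : T * 'I_p -> nat => exists (C : T -> nat) (h : 'I_p -> T -> nat),
  (forall j, dec (h j)) /\ forall t j, g (t, j) = (C t + h j t)%N).
have sumE (g : T * 'I_p -> nat) : (\sum_x g x = \sum_(j < p) \sum_(t : T) g (t, j))%N.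
  by rewrite exchange_big pair_bigA; apply: eq_bigr => -[].
split=> [[t j]|y y1|g [C [h [dec_h gE]]]|g [t j] [C [h [dec_h gE]]]|f sum0 lt_f].
- have zpm : z ^+ (p * m) = 1 by rewrite exprM (prim_expr_order prim_z) expr1n.
  by rewrite exprMn exprAC zpm expr1n mulr1 mulnC exprM (rs_root sysT) expr1n.
- have [x [x' [-> xm x'p]]] := root_coprime_split co_pm y1.
  have [j ->] := prim_rootP prim_z x'p.
  have [i [t ->]] := rs_cover sysT xm.
  by exists i, (t, j); rewrite mulrA.
- rewrite sumE; under eq_bigr => j _ do under eq_bigr => t _ do rewrite gE.
  under eq_bigr => j _ do rewrite big_split /=.
  rewrite big_split /= sum_nat_const card_ord.
  apply: nat_spanD; first by rewrite mulnC; apply: nat_spanMl; apply: nat_span_mem.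
  by apply: nat_span_sum => j; apply: (rs_span sysT).
- rewrite sumE gE mulnDr; under eq_bigr => j' _ do under eq_bigr => t' _ do rewrite gE.
  under eq_bigr => j' _ do rewrite big_split /=.
  rewrite big_split /= sum_nat_const card_ord; apply: leq_add.
    by apply: leq_mul => //; rewrite (bigD1 t) //= leq_addr.
  rewrite (bigD1 j) //=; apply: leq_trans (leq_addr _ _).
  exact: (rs_bound sysT).
pose a j := \sum_i \sum_t (f i (t, j))%:R * (eta ^+ i * w t).
have a_const : forall j1 j2, a j1 = a j2.
  apply: (prim_root_sum_eq0_coprime pr_p m_gt0 co_pm prim_z).
    by move=> j; apply: in_cyclotomic_sum => //; apply: rs_root sysT.
  rewrite -[RHS]sum0.
  under eq_bigr => j _ do rewrite mulr_suml.
  rewrite exchange_big; apply: eq_bigr => i _ /=.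
  under eq_bigr => j _ do rewrite mulr_suml.
  rewrite exchange_big pair_bigA; apply: eq_bigr => -[t j] _ /=.
  by rewrite !mulrA.
pose eps j := (\sum_i \sum_t f i (t, j))%N.
have lenE : (\sum_i \sum_x f i x = \sum_j eps j)%N.
  by rewrite [RHS]exchange_big; apply: eq_bigr => i _; rewrite sumE.
rewrite lenE in lt_f.
have [j0 _ j0_min] : exists2 j0, true & forall j, (eps j0 <= eps j)%N.
  case: (arg_minnP eps (i0 := Ordinal p_gt0) (P := predT)) => // j0 _ j0P.
  by exists j0 => // j; apply: j0P.
pose S t := (\sum_i f i (t, j0))%N.
have sumS : (\sum_t S t = eps j0)%N by rewrite exchange_big.
suff /fin_all_exists[c /fin_all_exists[g cgP]] j : exists c (g : 'I_q -> T -> nat),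
    (forall i, dec (g i)) /\
    forall i t, f i (t, j) = (c t + (f i (t, j0) + g i t))%N.
  exists (fun x => c x.2 x.1), (fun i x => f i (x.1, j0) + g x.2 i x.1)%N; split.
    move=> i; exists (fun t => f i (t, j0)), (fun j => g j i); split=> // j.
    by case: (cgP j).
  by move=> i [t j]; case: (cgP j) => _ ->.
(* As [sum_i eta ^+ i = 0], replacing [- x] by the sum of the other elements *)
(* of its [eta]-coset turns the difference of slices [j] and [j0] into a     *)
(* vanishing sum [y] with weights in [nat].                                  *)
pose y i t := (f i (t, j) + \sum_(i' | i' != i) f i' (t, j0))%N.
have yE i t : (y i t + f i (t, j0) = f i (t, j) + S t)%N.
  by rewrite /y /S [in RHS](bigD1 i) //= addnAC -!addnA.
have y_sum : \sum_i \sum_t (y i t)%:R * (eta ^+ i * w t) = 0.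
  apply: (addIr (a j0)); rewrite add0r {2}(a_const j0 j).
  have S0 : \sum_(i < q) \sum_t (S t)%:R * (eta ^+ i * w t) = 0.
    rewrite exchange_big big1 // => t _.
    under eq_bigr => i _ do rewrite mulrCA.
    by rewrite -mulr_suml sum_prim_root mul0r.
  rewrite -[RHS]addr0 -[X in _ = _ + X]S0 /a -!big_split; apply: eq_bigr => i _.
  by rewrite -!big_split; apply: eq_bigr => t _ /=; rewrite -!mulrDl -!natrD yE.
have y_len : (\sum_i \sum_t y i t + eps j0 = eps j + q * eps j0)%N.
  rewrite /eps -big_split /=; under eq_bigr => i _ do rewrite -big_split /=.
  under eq_bigr => i _ do under eq_bigr => t _ do rewrite yE.
  under eq_bigr => i _ do rewrite big_split /= sumS.
  by rewrite big_split /= sum_nat_const card_ord.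
(* [y] has size [eps j + (q - 1) * eps j0], while each of the [p - 1] slices other than [j] weighs
   at least [eps j0]. *)
have le_l : (\sum_i \sum_t y i t + (p - q) * eps j0 <= \sum_j eps j)%N.
  have : (eps j + (p - 1) * eps j0 <= \sum_j eps j)%N.
    rewrite (bigD1 j) //= leq_add2l; have -> : (p - 1 = #|predC1 j|)%N.
      by rewrite cardC1 card_ord subn1.
    by rewrite -sum_nat_const; apply: leq_sum.
  have -> : (p - 1 = (p - q) + (q - 1))%N by have := prime_gt0 pr_q; lia.
  have qE : (q * eps j0 = (q - 1) * eps j0 + eps j0)%N.
    by have := prime_gt0 pr_q; case: (q) => // q' _; rewrite subn1 mulSn addnC.
  move: y_len; rewrite qE !mulnDl; lia.
have lt_y : (\sum_i \sum_t y i t < (q - 1) * (p2 - 1))%N.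
  by apply: leq_ltn_trans lt_f; apply: leq_trans le_l; rewrite leq_addr.
have [c [g [dec_g cgE]]] := rs_dec sysT y_sum lt_y.
(* Over [t], [y] is the difference of the slices plus [S t] full [eta]-cosets. Slice [j0] lies
   inside slice [j] as soon as these can be taken back from the [c t] cosets found. *)
have S_le t : (S t <= c t)%N.
  apply: (fiber_count_bound (G := (\sum_i g i t)%N) le_p2p _ _ _ le_l lt_f).
  - by rewrite -sumS (bigD1 t) //= leq_addr.
  - have sq k : (\sum_(i < q) k = q * k)%N by rewrite sum_nat_const card_ord.
    rewrite -[(q * S t)%N]sq -[(q * c t)%N]sq {2}/S.
    by rewrite -!big_split /=; apply: leq_sum => i _; rewrite -cgE yE leq_addl.
  under [X in (_ <= X)%N]eq_bigr => i _ do under eq_bigr => t' _ do rewrite cgE.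
  under [X in (_ <= X)%N]eq_bigr => i _ do rewrite big_split /=.
  rewrite big_split /= sum_nat_const card_ord; apply: leq_add.
    by rewrite leq_mul2l (bigD1 t) //= leq_addr orbT.
  by rewrite big_distrr; apply: leq_sum => i _; apply: (rs_bound sysT).
exists (fun t => c t - S t)%N, g; split=> // i t.
have := yE i t; rewrite cgE; have := S_le t; lia.
Qed.

(** Primes are stripped from [n %/ q], so that [q] divides every intermediate order. Repeated
    primes, [q] included, fall under [root_system_dvd], new ones under [root_system_coprime]. *)
Lemma root_system_exists n :
    (0 < n)%N -> (q %| n)%N ->
    (forall p, prime p -> (p %| n)%N -> p \in ps /\ (p != q -> p2 <= p)%N) ->
  exists (T : finType) w dec, @root_system n T w dec.
Proof.
elim/ltn_ind: n => n IHn n_gt0 q_dv_n primes_n.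
have q_gt0 := prime_gt0 pr_q.
have [nq1|nq1] := eqVneq (n %/ q)%N 1%N.
  rewrite -(divnK q_dv_n) nq1 mul1n.
  by do 3!eexists; exact: root_system_base.
set p := pdiv (n %/ q).
have nq_gt0 : (0 < n %/ q)%N by rewrite divn_gt0 // dvdn_leq.
have pr_p : prime p by rewrite pdiv_prime // ltn_neqAle eq_sym nq1.
have [m nqE] : exists m, (n %/ q = m * p)%N by apply/dvdnP; exact: pdiv_dvd.
have nE : n = (p * (m * q))%N by rewrite -(divnK q_dv_n) nqE; ring.
have mq_gt0 : (0 < m * q)%N by move: n_gt0; rewrite nE muln_gt0 => /andP[].
have q_dv_mq : (q %| m * q)%N by rewrite dvdn_mull.
have [||T [w [dec sysT]]] := IHn (m * q)%N _ mq_gt0 q_dv_mq.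
- by rewrite nE ltn_Pmull // prime_gt1.
- by move=> r pr_r r_dv; apply: primes_n => //; rewrite nE dvdn_mull.
rewrite nE; have [p_dv|p_ndv] := boolP (p %| m * q)%N.
  exact: root_system_dvd sysT.
have [ps_p le_p] := primes_n p pr_p (dvdn_trans (pdiv_dvd _) (dvdn_div q_dv_n)).
apply: root_system_coprime sysT => //; first by rewrite prime_coprime.
by apply: le_p; apply: contraNneq p_ndv => ->.
Qed.

(** Coordinates of a root need not be unique: one pair is chosen per term, and the weights count the
    terms. *)
Lemma root_system_size n (T : finType) (w : T -> algC) dec N (s : 'I_N -> algC) :
    q \in ps -> root_system n w dec -> (forall k, s k ^+ n = 1) ->
    \sum_k s k = 0 -> (N < (q - 1) * (p2 - 1))%N ->
  nat_span ps N.
Proof.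
move=> ps_q sysT sn sum0 ltN.
have /fin_all_exists[I /fin_all_exists[t itE]] k := rs_cover sysT (sn k).
pose f i u := (\sum_k ((I k == i) && (t k == u)))%N.
have NE : N = (\sum_i \sum_u f i u)%N.
  rewrite pair_bigA exchange_big /= -[LHS]card_ord -sum1_card; apply: eq_bigr => k _.
  rewrite (bigD1 (I k, t k)) //= !eqxx big1 // => -[i u] /=.
  by rewrite eq_sym xpair_eqE => /negPf->.
have := rs_dec sysT (f := f); rewrite -NE => -[|//|c [g [dec_g fE]]].
  rewrite -[RHS]sum0 pair_bigA /=.
  under eq_bigr => iu _ do rewrite /f natr_sum mulr_suml.
  rewrite exchange_big /=; apply: eq_bigr => k _.
  rewrite (bigD1 (I k, t k)) //= !eqxx mul1r -itE big1 ?addr0 // => -[i u] /=.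
  by rewrite eq_sym xpair_eqE => /negPf->; rewrite mul0r.
rewrite NE; under eq_bigr => i _ do under eq_bigr => u _ do rewrite fE.
under eq_bigr => i _ do rewrite big_split /=.
rewrite big_split /= sum_nat_const card_ord; apply: nat_spanD.
  by rewrite mulnC; apply: nat_spanMl; apply: nat_span_mem.
by apply: nat_span_sum => i; apply: (rs_span sysT).
Qed.

End LamLeung.

Theorem lam_leung_algC n N (s : 'I_N -> algC) :
    (0 < n)%N -> (forall k, s k ^+ n = 1) -> \sum_k s k = 0 ->
  nat_span (primes n) N.
Proof.
move=> n_gt0 sn sum0.
have [n1|n_gt1] := leqP n 1.
  have n1E : n = 1%N by lia.
  suff -> : N = 0%N by exact: nat_span0.
  apply/eqP; rewrite -(pnatr_eq0 algC) -sum0 -{1}[N]card_ord -sumr_const.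
  by apply/eqP/eq_bigr => k _; have := sn k; rewrite n1E expr1.
have uniq_n := primes_uniq n; have sorted_n := sorted_primes n.
have [l0 primes_nE] : exists l0, primes n = l0 by eexists.
rewrite primes_nE in sorted_n; case: l0 primes_nE sorted_n => [|q l] primes_nE.
  have : pdiv n \in primes n by rewrite mem_primes pdiv_prime // n_gt0 pdiv_dvd.
  by rewrite primes_nE.
move=> /= path_l.
have q_in : q \in primes n by rewrite primes_nE mem_head.
have /and3P[pr_q _ q_dv] : [&& prime q, (0 < n)%N & (q %| n)%N] by rewrite -mem_primes.
(* When [n] is a prime power there is no second prime; the default value is large enough to put [N]
   in the short case. *)
pose p2 := head (maxn q N).+2 l.
have all_l : all (fun p => q < p)%N l.
  by move: path_l; rewrite path_sortedE => [/andP[]//|]; exact: ltn_trans.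
have q_lt : (q < p2)%N by move: all_l; rewrite /p2; case: (l) => [_|p l' /andP[]//] /=; lia.
have le_p2 p : p \in l -> (p2 <= p)%N.
  rewrite /p2; case: (l) path_l => // r l' /= /andP[_ pl'].
  rewrite inE => /orP[/eqP-> //|l'p]; move: pl'; rewrite path_sortedE; last exact: ltn_trans.
  by case/andP => /allP/(_ _ l'p)/ltnW.
have [ltN|leN] := ltnP N ((q - 1) * (p2 - 1)); last first.
  case lE : l => [|r l'].
    move: leN; rewrite /p2 lE /= => leN.
    have : (1 * ((maxn q N).+2 - 1) <= (q - 1) * ((maxn q N).+2 - 1))%N.
      by rewrite leq_mul2r; apply/orP; right; have := prime_gt1 pr_q; lia.
    lia.
  have r_in : r \in primes n by rewrite primes_nE lE !inE eqxx orbT.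
  have p2E : p2 = r by rewrite /p2 lE.
  move: r_in (r_in); rewrite {1}mem_primes => /and3P[pr_r _ _] r_in.
  apply: (nat_span_large uniq_n q_in r_in); last by rewrite -p2E.
    by rewrite prime_coprime // dvdn_prime2 // -p2E neq_ltn q_lt.
  exact: prime_gt0.
have [eta prim_eta] := C_prim_root_exists (prime_gt0 pr_q).
have [|T [w [dec sysT]]] := root_system_exists uniq_n pr_q q_lt prim_eta n_gt0 q_dv.
  move=> p pr_p p_dv.
  have p_in : p \in primes n by rewrite mem_primes pr_p n_gt0.
  split=> // pq; apply: le_p2; move: p_in.
  by rewrite primes_nE inE (negPf pq).
by apply: (root_system_size uniq_n q_in sysT sn sum0 ltN).
Qed.

(** * Transfer from [algC] to any algebraically closed numeric field *)

Lemma prim_root_exists (C : numClosedFieldType) n :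
  (0 < n)%N -> exists z : C, n.-primitive_root z.
Proof.
move=> n_gt0; have [r Dp] := closed_field_poly_normal ('X^n - 1 : {poly C}).
rewrite (monicP _) ?monicXnsubC // scale1r in Dp.
have rn1 : all n.-unity_root r by apply/allP => z; rewrite -root_prod_XsubC -Dp.
have sz_r : (n < (size r).+1)%N.
  by rewrite -(size_prod_XsubC r id) -Dp size_XnsubC.
have [|z] := hasP (has_prim_root n_gt0 rn1 _ sz_r); last by exists z.
by rewrite -separable_prod_XsubC -Dp separable_Xn_sub_1 // pnatr_eq0 -lt0n.
Qed.

Lemma root_Cyclotomic (C : numClosedFieldType) n (z : C) :
  n.-primitive_root z -> root (map_poly intr 'Phi_n) z.
Proof.
move=> prim_z; have n_gt0 := prim_order_gt0 prim_z.
have map_prod d : (0 < d)%N ->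
    \prod_(e <- divisors d) map_poly (intr : int -> C) 'Phi_e = 'X^d - 1.
  by move=> d_gt0; rewrite -rmorph_prod prod_Cyclotomic // rmorphB rmorph1 /= map_polyXn.
have : root (\prod_(e <- divisors n) map_poly (intr : int -> C) 'Phi_e) z.
  by rewrite map_prod // /root !hornerE (prim_expr_order prim_z) subrr.
rewrite {1}/root horner_prod prodf_seq_eq0 => /hasP[d d_dv /= root_d].
have {}d_dv : (d %| n)%N by rewrite dvdn_divisors.
have d_gt0 := dvdn_gt0 n_gt0 d_dv.
suff n_dv : (n %| d)%N.
  by have -> : n = d by apply/eqP; rewrite eqn_dvd n_dv.
rewrite (prim_order_dvd prim_z) -subr_eq0.
suff : root ('X^d - 1) z by rewrite /root !hornerE.
by rewrite -map_prod // (big_rem d) -?dvdn_divisors //= rootM {1}/root root_d.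
Qed.

(** The relation says that a sum of powers of [X] shares a root with ['Phi_n]. Both are defined over
    the rationals, so non-coprimality descends there and yields a common root in [algC], again
    primitive of order [n]. *)
Theorem lam_leung (C : numClosedFieldType) n N (s : 'I_N -> C) :
    (0 < n)%N -> (forall k, s k ^+ n = 1) -> \sum_k s k = 0 ->
  nat_span (primes n) N.
Proof.
move=> n_gt0 sn sum0; have [z prim_z] := prim_root_exists C n_gt0.
have /fin_all_exists[e eE] k : exists e : 'I_n, s k = z ^+ e.
  by have [e ->] := prim_rootP prim_z (sn k); exists e.
pose F (K : fieldType) := \sum_k 'X^(e k) : {poly K}.
pose P (K : fieldType) := map_poly intr 'Phi_n : {poly K}.
have mapF (K : numFieldType) : map_poly ratr (F rat) = F K.
  by rewrite rmorph_sum; apply: eq_bigr => k _; rewrite /= map_polyXn.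
have mapP (K : numFieldType) : map_poly ratr (P rat) = P K.
  by rewrite -map_poly_comp; apply: eq_map_poly => x; rewrite /= rmorph_int.
have ncop : ~~ coprimep (P rat) (F rat).
  rewrite -(coprimep_map (ratr : {rmorphism rat -> C})) mapF mapP.
  apply/negP => /coprimep_root/(_ (root_Cyclotomic prim_z)).
  rewrite horner_sum; under eq_bigr => k _ do rewrite hornerXn -eE.
  by rewrite sum0 eqxx.
move: ncop; rewrite -(coprimep_map (ratr : {rmorphism rat -> algC})) mapF mapP.
move=> /closed_rootP[y]; rewrite root_gcd => /andP[Py Fy].
have [z' prim_z'] := C_prim_root_exists n_gt0.
rewrite /P (Cintr_Cyclotomic prim_z') root_cyclotomic // in Py.
apply: (@lam_leung_algC n N (fun k => y ^+ e k)) => //.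
  by move=> k; rewrite exprAC (prim_expr_order Py) expr1n.
move: Fy; rewrite /root horner_sum => /eqP.
by under eq_bigr => k _ do rewrite hornerXn.
Qed.

(** * Irreducible representations of a product of two abelian subgroups *)

Section Schur.

Variables (C : numClosedFieldType) (gT : finGroupType) (G : {group gT}).
Variables (d : nat) (rG : mx_representation C G d).
Hypothesis irrG : mx_irreducible rG.

Lemma mx_irr_gt0 : (0 < d)%N.
Proof. by have /mx_irrP[] := irrG. Qed.

Lemma mx_irr_cent_scalar (A : 'M_d) :
  {in G, forall x, A *m rG x = rG x *m A} -> is_scalar_mx A.
Proof.
move=> cGA; apply: (mx_abs_irr_cent_scalar (rG := rG)); last exact/centgmxP.
exact: group_closure_closed_field.
Qed.

Lemma mx_irr_average (B : 'M_d) :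
  \sum_(x in G) rG x *m B *m rG x^-1%g = (#|G|%:R / d%:R * \tr B)%:M.
Proof.
have d0 : d%:R != 0 :> C by rewrite pnatr_eq0 -lt0n mx_irr_gt0.
set A := \sum_(x in G) _.
have /is_scalar_mxP[a AE] : is_scalar_mx A.
  apply: mx_irr_cent_scalar => y Gy; rewrite mulmx_suml mulmx_sumr.
  rewrite (reindex_inj (mulgI y)) /=; apply: eq_big => [x|x]; rewrite groupMl // => Gx.
  by rewrite invMg !repr_mxM ?groupV // -!mulmxA -repr_mxM ?groupV // mulVg repr_mx1 mulmx1.
have : \tr A = #|G|%:R * \tr B.
  rewrite raddf_sum /= mulr_natl -sumr_const; apply: eq_bigr => x Gx.
  by rewrite mxtrace_mulC mulmxA -repr_mxM ?groupV // mulVg repr_mx1 mul1mx.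
rewrite AE mxtrace_scalar => trA; congr (_%:M).
by rewrite mulrAC -trA -(mulr_natr a) mulfK.
Qed.

(** Averaging elementary matrices gives the case [y = 1], and translation the rest. It recovers
    [rG y] from translated values of the character. *)
Lemma mx_irr_char_conv (y : gT) : y \in G ->
  \sum_(x in G) \tr (rG (y * x)%g) *: rG x^-1%g = (#|G|%:R / d%:R) *: rG y.
Proof.
move=> Gy.
have conv1 : \sum_(x in G) \tr (rG x) *: rG x^-1%g = (#|G|%:R / d%:R)%:M.
  apply/matrixP => j k; rewrite summxE.
  transitivity (\sum_i (\sum_(x in G) rG x *m delta_mx i j *m rG x^-1%g) i k).
    rewrite (eq_bigr _ (fun i _ => summxE _ _ _ i k)) exchange_big /=.
    apply: eq_bigr => x _; rewrite mxE mulr_suml; apply: eq_bigr => i _.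
    rewrite mxE (bigD1 j) //= big1 ?addr0 => [|l lj].
      rewrite mxE (bigD1 i) //= big1 ?addr0 ?mxE ?eqxx ?mulr1 // => l li.
      by rewrite mxE (negPf li) mulr0.
    by rewrite mxE big1 ?mul0r // => l' _; rewrite mxE (negPf lj) andbF mulr0.
  under eq_bigr => i _ do rewrite mx_irr_average mxE.
  rewrite mxE (bigD1 k) //= eqxx mulr1n big1 => [|i /negPf-> //].
  rewrite addr0 /mxtrace (bigD1 j) //= big1 ?addr0 => [|l lj].
    by rewrite mxE eqxx andbT; case: (j == k); rewrite ?mulr1 ?mulr0 ?mulr1n ?mulr0n.
  by rewrite mxE (negPf lj) andbF.
rewrite -mul_scalar_mx -conv1 mulmx_suml (reindex_inj (mulgI y^-1%g)) /=.
apply: eq_big => [x|x]; rewrite groupMl ?groupV // => Gx.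
by rewrite mulKVg invMg invgK repr_mxM ?groupV // scalemxAl.
Qed.

End Schur.

Section Clifford.

Variables (C : numClosedFieldType) (gT : finGroupType) (G K H : {group gT}).
Variables (d : nat) (rG : mx_representation C G d).
Hypotheses (irrG : mx_irreducible rG) (nKG : (K <| G)%g) (KH_G : (K * H)%g = G).
Hypotheses (abK : abelian K) (abH : abelian H).

Let sKG : K \subset G. Proof. exact: normal_sub. Qed.
Let sHG : H \subset G. Proof. by rewrite -KH_G mulG_subr. Qed.
Let inKG k : k \in K -> k \in G. Proof. exact: (subsetP sKG). Qed.
Let inHG h : h \in H -> h \in G. Proof. exact: (subsetP sHG). Qed.
Let conjK k h : k \in K -> h \in H -> (k ^ h)%g \in K.
Proof. by move=> Kk Hh; rewrite memJ_norm // (subsetP (normal_norm nKG)) ?inHG. Qed.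

Let splitG x : x \in G -> exists k h, [/\ k \in K, h \in H & x = (k * h)%g].
Proof. by rewrite -{1}KH_G => /mulsgP[k h Kk Hh ->]; exists k, h. Qed.

Lemma abelian_weight_exists :
  exists (v : 'rV_d) (lam : gT -> C),
    v != 0 /\ {in K, forall k, v *m rG k = lam k *: v}.
Proof.
have [||v v0 vP] := @common_eigenvector C d [seq rG k | k <- enum K].
- exact: mx_irr_gt0 irrG.
- move=> _ _ /mapP[k Kk ->] /mapP[l Kl ->]; rewrite !mem_enum in Kk Kl.
  by rewrite /comm_mx -!repr_mxM ?inKG // (centsP abK).
suff /fin_all_exists[lam lamP] (k : gT) : exists a, k \in K -> v *m rG k = a *: v.
  by exists v, lam; split=> // k Kk; apply: lamP.
(* Weights are specified on [K] only; 0 is the default value elsewhere. *)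
have [Kk|_] := boolP (k \in K); last by exists 0.
have /sub_rVP[a aE] : stablemx v (rG k).
  by move/allP: vP; apply; apply: map_f; rewrite mem_enum.
by exists a.
Qed.

Section Weight.

Variables (v : 'rV[C]_d) (lam : gT -> C).
Hypotheses (v0 : v != 0) (vP : {in K, forall k, v *m rG k = lam k *: v}).

Let hv h : 'rV_d := v *m rG h.
Let hlam h k := lam (k ^ h^-1)%g.

Lemma weight_conj h k : h \in H -> k \in K -> hv h *m rG k = hlam h k *: hv h.
Proof.
move=> Hh Kk; rewrite /hv /hlam scalemxAl -vP ?conjK ?groupV // -!mulmxA.
have [Gh Gk] := (inHG Hh, inKG Kk).
by rewrite -!repr_mxM ?groupJ ?groupV // -conjgCV.
Qed.

Lemma weight_neq0 h : h \in H -> hv h != 0.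
Proof.
move=> Hh; apply: contraNneq v0 => hv0.
by rewrite -[v](repr_mxK rG (inHG Hh)) -/(hv h) hv0 mul0mx.
Qed.

Lemma weightM k l : k \in K -> l \in K -> lam (k * l)%g = lam k * lam l.
Proof.
move=> Kk Kl.
have : (lam (k * l)%g - lam k * lam l) *: v = 0.
  rewrite scalerBl -vP ?groupM // repr_mxM ?inKG // mulmxA vP // -scalemxAl vP //.
  by rewrite scalerA subrr.
by move/eqP; rewrite scaler_eq0 (negPf v0) orbF subr_eq0 => /eqP.
Qed.

Lemma weight1 : lam 1%g = 1.
Proof.
have : (lam 1%g - 1) *: v = 0 by rewrite scalerBl -vP // repr_mx1 mulmx1 scale1r subrr.
by move/eqP; rewrite scaler_eq0 (negPf v0) orbF subr_eq0 => /eqP.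
Qed.

Lemma weightX k n : k \in K -> lam (k ^+ n)%g = lam k ^+ n.
Proof.
move=> Kk; elim: n => [|n IHn]; first by rewrite weight1.
by rewrite expgS exprS weightM ?groupX // IHn.
Qed.

(** The span of the translates is stable under [K], being spanned by weight vectors, and under [H];
    irreducibility makes it everything. *)
Lemma row_full_weights m (U : 'M_(m, d)) :
  {in H, forall h, hv h <= U}%MS -> row_full U.
Proof.
move=> sHU; pose W := (\sum_(h in H) <<hv h>>)%MS.
have sWU : (W <= U)%MS by apply/sumsmx_subP => h Hh; rewrite genmxE sHU.
have /mx_irrP[_ irr] := irrG.
rewrite -sub1mx; apply: submx_trans sWU; rewrite sub1mx; apply: irr.
  apply/mxmoduleP => _ /splitG[k [h [Kk Hh ->]]].
  rewrite sumsmxMr; apply/sumsmx_subP => h' Hh'.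
  have [Gk Gh] := (inKG Kk, inHG Hh).
  rewrite (eqmxMr _ (genmxE _)) repr_mxM // mulmxA weight_conj //.
  rewrite -scalemxAl scalemx_sub // -mulmxA -repr_mxM ?inHG //.
  by rewrite (sumsmx_sup (h' * h)%g) ?groupM // genmxE.
apply: contraNneq v0 => W0; rewrite -submx0 -W0.
by rewrite (sumsmx_sup 1%g) // genmxE /hv repr_mx1 mulmx1.
Qed.

Lemma weights_eq0 (B : 'M_d) : {in H, forall h, hv h *m B = 0} -> B = 0.
Proof.
move=> hB; have /row_fullP[D DE] : row_full (kermx B).
  by apply: row_full_weights => h Hh; apply/sub_kermxP; rewrite hB.
by rewrite -[B]mul1mx -DE -mulmxA mulmx_ker mulmx0.
Qed.

(** Such an [rG h] commutes with [rG k] on every translate, because [H] is abelian, and with the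
    image of [H]; Schur's lemma applies. *)
Lemma weight_fix_scalar h :
  h \in H -> {in K, forall k, hlam h k = lam k} -> is_scalar_mx (rG h).
Proof.
move=> Hh fix_h; apply: (mx_irr_cent_scalar irrG) => _ /splitG[k [h' [Kk Hh' ->]]].
suff cKh : rG h *m rG k = rG k *m rG h.
  have [Gk Gh Gh'] := And3 (inKG Kk) (inHG Hh) (inHG Hh').
  rewrite repr_mxM // mulmxA cKh -!mulmxA -!repr_mxM ?groupM //.
  by rewrite (centsP abH _ Hh _ Hh').
apply/eqP; rewrite -subr_eq0; apply/eqP/weights_eq0 => y Hy.
have Hyh : (y * h)%g \in H by rewrite groupM.
have hvM : hv y *m rG h = hv (y * h)%g by rewrite /hv repr_mxM ?inHG // mulmxA.
rewrite mulmxBr !mulmxA (weight_conj Hy Kk) -scalemxAl hvM (weight_conj Hyh Kk).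
rewrite (centsP abH _ Hy _ Hh) /hlam invMg conjgM [lam (_ ^ h^-1)%g]fix_h ?subrr //.
by rewrite conjK ?groupV.
Qed.

Lemma weight_eq_scalar h1 h2 : h1 \in H -> h2 \in H ->
  {in K, hlam h1 =1 hlam h2} -> is_scalar_mx (rG (h1 * h2^-1)%g).
Proof.
move=> Hh1 Hh2 eq12; apply: weight_fix_scalar; first by rewrite groupM ?groupV.
move=> k Kk; have := eq12 (k ^ h2)%g (conjK Kk Hh2).
by rewrite /hlam invMg invgK conjgM => ->; rewrite conjgK.
Qed.

Lemma weight_conjM h k l : h \in H -> k \in K -> l \in K -> hlam h (k * l)%g = hlam h k * hlam h l.
Proof. by move=> Hh Kk Kl; rewrite /hlam conjMg weightM ?conjK ?groupV. Qed.

Lemma weight_conjV h k : h \in H -> k \in K -> hlam h k^-1%g * hlam h k = 1.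
Proof.
by move=> Hh Kk; rewrite -weight_conjM ?groupV // mulVg /hlam conj1g weight1.
Qed.

Lemma weight_orthogonal h1 h2 : h1 \in H -> h2 \in H ->
    ~~ is_scalar_mx (rG (h1 * h2^-1)%g) ->
  \sum_(k in K) hlam h1 k^-1%g * hlam h2 k = 0.
Proof.
move=> Hh1 Hh2; set S := \sum_(k in K) _ => nscal.
have [k0 Kk0 ne_k0] : exists2 k, k \in K & hlam h1 k != hlam h2 k.
  apply/exists_inP; apply: contraR nscal => /exists_inPn eq12.
  by apply: weight_eq_scalar => // k /eq12; rewrite negbK => /eqP.
have SE : S = hlam h1 k0^-1%g * hlam h2 k0 * S.
  rewrite mulr_sumr {1}/S (reindex_inj (mulgI k0)) /=.
  apply: eq_big => [k|k]; rewrite groupMl // => Kk.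
  by rewrite invMg !weight_conjM ?groupV //; ring.
have /eqP : (1 - hlam h1 k0^-1%g * hlam h2 k0) * S = 0.
  by rewrite mulrBl mul1r -SE subrr.
rewrite mulf_eq0 => /orP[|/eqP //]; rewrite subr_eq0 => /eqP E1.
case/eqP: ne_k0; rewrite -[RHS]mul1r -(weight_conjV Hh1 Kk0).
by rewrite mulrAC -E1 mul1r.
Qed.

(** By [weight_eq_scalar], distinct cosets of [T] carry distinct weights. *)
Let T := (H :&: rcenter_group rG)%G.
Let N := #|rcosets T H|.
Let rep (j : 'I_N) : gT := repr (enum_val j).

Let rep_in j : rep j \in H.
Proof.
have /rcosetsP[h Hh jE] := enum_valP j.
rewrite /rep jE; have /rcosetP[t] := mem_repr_rcoset T h.
by rewrite inE => /andP[Ht _] ->; rewrite groupM.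
Qed.

Let rep_coset h : h \in H -> exists j, exists2 t, t \in T & h = (t * rep j)%g.
Proof.
move=> Hh; have jP : (T :* h)%g \in rcosets T H by apply/rcosetsP; exists h.
exists (enum_rank_in jP (T :* h)%g); rewrite /rep enum_rankK_in //.
have /rcosetP[t Tt ->] := mem_repr_rcoset T h.
by exists t^-1%g; rewrite ?groupV // mulKg.
Qed.

Let rep_inj j1 j2 : (rep j1 * (rep j2)^-1)%g \in T -> j1 = j2.
Proof.
move=> Tj; apply: enum_val_inj.
have jE j : enum_val j = (T :* rep j)%g.
  by have /rcosetsP[h Hh jE] := enum_valP j; rewrite /rep jE rcoset_repr.
by rewrite !jE; apply/rcoset_eqP; rewrite mem_rcoset.
Qed.

Let Q : 'M_(N, d) := \matrix_j hv (rep j).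

Let hvT t h : t \in T -> h \in H ->
  exists2 a, is_true (a != 0) & hv (t * h)%g = a *: hv h.
Proof.
rewrite inE => /andP[Ht]; rewrite inE => /andP[Gt /is_scalar_mxP[a aE]] Hh.
have tE : hv (t * h)%g = a *: hv h.
  by rewrite /hv repr_mxM ?inHG // aE mul_scalar_mx -scalemxAr.
exists a => //; apply: contraNneq (weight_neq0 (groupM Ht Hh)) => a0.
by rewrite tE a0 scale0r.
Qed.

(** [Q] is rectangular until [N = d] is known, so both one-sided inverses are recorded; comparing
    traces of identities then gives [N = d]. *)
Lemma weight_basis : exists2 Q', Q' *m Q = 1%:M & Q *m Q' = 1%:M.
Proof.
have /row_fullP[Q1 Q1Q] : row_full Q.
  apply: row_full_weights => h /rep_coset[j [t Tt ->]].
  have [a _ ->] := hvT Tt (rep_in j).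
  by rewrite scalemx_sub // (eq_row_sub j) // rowK.
have /row_freeP[Q2 QQ2] : row_free Q.
  apply: inj_row_free => u uQ; apply/rowP => i; rewrite mxE.
  (* Up to the factor [#|K|], the projector onto the weight of [rep i]: by orthogonality of distinct
     weights it kills the other rows. *)
  pose E := \sum_(k in K) hlam (rep i) k^-1%g *: rG k.
  have hvE j : hv (rep j) *m E = (if j == i then #|K|%:R else 0) *: hv (rep j).
    have -> : hv (rep j) *m E =
        (\sum_(k in K) hlam (rep i) k^-1%g * hlam (rep j) k) *: hv (rep j).
      rewrite scaler_suml mulmx_sumr; apply: eq_bigr => k Kk.
      by rewrite -scalemxAr weight_conj // scalerA.
    congr (_ *: _); have [->|ji] := eqVneq j i.
      by rewrite -sumr_const; apply: eq_bigr => k Kk; rewrite weight_conjV.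
    apply: weight_orthogonal => //; apply: contra ji => scal.
    rewrite eq_sym; apply/eqP/rep_inj; rewrite inE groupM ?groupV //= inE scal andbT.
    by rewrite inHG // groupM ?groupV.
  have : u *m Q *m E = 0 by rewrite uQ mul0mx.
  rewrite (mulmx_sum_row u) mulmx_suml (bigD1 i) //= big1 => [|j ji]; last first.
    by rewrite rowK -scalemxAl hvE (negPf ji) scale0r scaler0.
  rewrite rowK -scalemxAl hvE eqxx addr0 scalerA => /eqP.
  rewrite scaler_eq0 (negPf (weight_neq0 _)) // orbF mulf_eq0.
  by rewrite pnatr_eq0 -[#|K| == 0%N]negbK -lt0n cardG_gt0 orbF => /eqP.
exists Q1 => //; suff -> : Q1 = Q2 by [].
by rewrite -[LHS]mulmx1 -QQ2 mulmxA Q1Q mul1mx.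
Qed.

Lemma weight_trace (B : 'M_d) (D : 'M_N) : Q *m B = D *m Q -> \tr B = \tr D.
Proof.
have [Q' Q'Q QQ'] := weight_basis => QB.
by rewrite -[B]mul1mx -Q'Q -mulmxA QB mulmxA mxtrace_mulC mulmxA QQ' mul1mx.
Qed.

Lemma weight_degree : N = d.
Proof.
apply/eqP; rewrite -(eqr_nat C) -[X in _ == X]mxtrace1 -mxtrace1 eq_sym; apply/eqP.
by apply: weight_trace; rewrite mulmx1 mul1mx.
Qed.

Lemma weight_char k : k \in K -> \tr (rG k) = \sum_j hlam (rep j) k.
Proof.
move=> Kk; rewrite (@weight_trace _ (diag_mx (\row_j hlam (rep j) k))).
  by rewrite mxtrace_diag; apply: eq_bigr => j _; rewrite mxE.
apply/row_matrixP => j; rewrite !row_mul row_diag_mx -scalemxAl -rowE !rowK.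
by rewrite weight_conj // mxE.
Qed.

(** [h] permutes the weight lines as it permutes the cosets of [T], without fixed point, and [k]
    only rescales them: the diagonal is zero in the weight basis. *)
Lemma weight_char0 k h : k \in K -> h \in H -> ~~ is_scalar_mx (rG h) ->
  \tr (rG (k * h)%g) = 0.
Proof.
move=> Kk Hh nscal.
have hT : h \notin T by rewrite !inE (negPf nscal) !andbF.
have /fin_all_exists[f /fin_all_exists[a faP]] (j : 'I_N) : exists i a,
    i != j /\ hv (rep j) *m rG (k * h)%g = a *: hv (rep i).
  have Hjh : (rep j * h)%g \in H by rewrite groupM.
  have [i [t Tt jhE]] := rep_coset Hjh; have [a _ aE] := hvT Tt (rep_in i).
  exists i, (hlam (rep j) k * a); split.
    apply: contraNneq hT => ij; suff -> : h = t by [].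
    apply: (mulgI (rep j)); rewrite jhE ij; have := Tt; rewrite inE => /andP[Ht _].
    by rewrite (centsP abH _ Ht _ (rep_in j)).
  have [Gk Gh] := (inKG Kk, inHG Hh).
  rewrite repr_mxM // mulmxA weight_conj // -scalemxAl.
  by rewrite /hv -mulmxA -repr_mxM ?inHG // -/(hv _) jhE aE scalerA.
rewrite (@weight_trace _ (\matrix_j (a j *: delta_mx 0 (f j)))).
  apply: big1 => j _; rewrite !mxE; case: (faP j) => fj _.
  by rewrite eq_sym (negPf fj) andbF mulr0.
apply/row_matrixP => j; rewrite !row_mul !rowK; case: (faP j) => _ ->.
by rewrite -scalemxAl -rowE rowK.
Qed.

Lemma weight_char_sum : exists n (s : 'I_n -> gT -> C), n = d /\ {in K, forall k,
    \tr (rG k) = \sum_j s j k /\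
    forall j, s j k ^+ #[k]%g = 1 /\ s j k^-1%g * s j k = 1}.
Proof.
exists N, (fun j => hlam (rep j)); split=> [|k Kk]; first exact: weight_degree.
rewrite weight_char //; split=> // j; rewrite weight_conjV //; split=> //.
by rewrite /hlam -weightX ?conjK ?groupV // -conjXg expg_order conj1g weight1.
Qed.

End Weight.

Theorem abelian_product_char :
  [/\ (d %| #|H|)%N,
      exists s : 'I_d -> gT -> C, {in K, forall k,
        \tr (rG k) = \sum_j s j k /\
        forall j, s j k ^+ #[k]%g = 1 /\ s j k^-1%g * s j k = 1}
    & {in H, forall h, is_scalar_mx (rG h) \/
        {in K, forall k, \tr (rG (k * h)%g) = 0}}].
Proof.
have [v [lam [v0 vP]]] := abelian_weight_exists.
split; last 1 first.
- move=> h Hh; have [|nscal] := boolP (is_scalar_mx (rG h)); first by left.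
  by right=> k Kk; apply: (weight_char0 v0 vP).
- by rewrite -(weight_degree v0 vP) dvdn_indexg.
have [N [s [Nd sP]]] := weight_char_sum v0 vP.
by subst N; exists s.
Qed.

Lemma unity_root_conj n (z : C) : (0 < n)%N -> z ^+ n = 1 -> z^* = z^-1.
Proof.
move=> n_gt0 zn; have /eqP : `|z| ^+ n = 1 by rewrite -normrX zn normr1.
rewrite pexpr_eq1 ?normr_ge0 // => /eqP z1.
by rewrite invC_norm z1 expr1n invr1 mul1r.
Qed.

(** On [K] the character is a sum of roots of unity. A scalar [h] contributes a root of unity as a
    factor, and for a non-scalar [h] both sides vanish. *)
Lemma abelian_product_char_conj :
  {in G, forall x, \tr (rG x^-1%g) = (\tr (rG x))^*}.
Proof.
have [_ [s sP] offT] := abelian_product_char.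
have trV k : k \in K -> \tr (rG k^-1%g) = (\tr (rG k))^*.
  move=> Kk; have [-> sk] := sP k Kk; have [-> _] := sP _ (groupVr Kk).
  rewrite rmorph_sum; apply: eq_bigr => j _ /=; have [sj1 sjV] := sk j.
  rewrite (unity_root_conj (order_gt0 k) sj1).
  have sj0 : s j k != 0 by apply: contra_eq_neq sjV => ->; rewrite mulr0 eq_sym oner_eq0.
  by apply: (mulIf sj0); rewrite sjV mulVf.
move=> _ /splitG[k [h [Kk Hh ->]]]; have [Gk Gh] := (inKG Kk, inHG Hh).
have [/is_scalar_mxP[a aE]|nscal] := boolP (is_scalar_mx (rG h)).
  have d_gt0 := mx_irr_gt0 irrG.
  have an : a ^+ #[h]%g = 1.
    have := repr_mx1 rG; rewrite -(expg_order h).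
    have -> m : rG (h ^+ m)%g = (a ^+ m)%:M.
      elim: m => [|m IHm]; first by rewrite repr_mx1.
      by rewrite expgS exprS repr_mxM ?groupX // IHm aE -scalar_mxM.
    by move/matrixP/(_ (Ordinal d_gt0) (Ordinal d_gt0)); rewrite !mxE eqxx.
  rewrite invMg !repr_mxM ?groupV // repr_mxV // aE invmx_scalar mul_scalar_mx.
  by rewrite mul_mx_scalar !mxtraceZ rmorphM /= (unity_root_conj (order_gt0 h) an) trV.
have [scal|off] := offT h Hh; first by rewrite scal in nscal.
rewrite off // rmorph0 invMg repr_mxM ?groupV // mxtrace_mulC -repr_mxM ?groupV //.
have [/is_scalar_mxP[a aE]|-> //] := offT _ (groupVr Hh); last by rewrite groupV.
case/negP: nscal; apply/is_scalar_mxP; exists a^-1.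
by rewrite -[h]invgK repr_mxV ?groupV // aE invmx_scalar.
Qed.

End Clifford.

(** * Recognizing scalar action and degree one *)

Section ScalarImage.

Variables (C : numClosedFieldType) (gT : finGroupType) (G : {group gT}).
Variables (d : nat) (rG : mx_representation C G d).
Hypothesis irrG : mx_irreducible rG.

(** [mx_irr_char_conv] turns proportionality of the translated character into proportionality of
    [rG y] and the identity. *)
Lemma char_translate_scalar (y : gT) (c : C) : y \in G ->
    {in G, forall x, \tr (rG (y * x)%g) = c * \tr (rG x)} ->
  is_scalar_mx (rG y).
Proof.
move=> Gy yc; have gd0 : #|G|%:R / d%:R != 0 :> C.
  by rewrite mulf_neq0 ?invr_eq0 ?pnatr_eq0 -?lt0n ?cardG_gt0 ?(mx_irr_gt0 irrG).
have conv1 := mx_irr_char_conv irrG (group1 G).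
have := mx_irr_char_conv irrG Gy.
have -> : \sum_(x in G) \tr (rG (y * x)%g) *: rG x^-1%g =
    c *: ((#|G|%:R / d%:R) *: rG 1%g).
  rewrite -conv1 scaler_sumr; apply: eq_bigr => x Gx.
  by rewrite mul1g scalerA yc.
rewrite [c *: _]scalerA [c * _]mulrC -(scalerA _ c) repr_mx1 => yE.
by rewrite -(scalerI gd0 yE) scalemx1 scalar_mx_is_scalar.
Qed.

Lemma mx_irr_scalar_linear :
  {in G, forall x, is_scalar_mx (rG x)} -> d = 1%N.
Proof.
move=> scal; have /mx_irrP[d_gt0 irr] := irrG.
pose U : 'M[C]_d := delta_mx (Ordinal d_gt0) (Ordinal d_gt0).
have : row_full U.
  apply: irr.
    apply/mxmoduleP => x Gx; have /is_scalar_mxP[a ->] := scal x Gx.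
    by rewrite mul_mx_scalar scalemx_sub.
  apply/eqP => /matrixP/(_ (Ordinal d_gt0) (Ordinal d_gt0)).
  by rewrite !mxE !eqxx => /eqP; rewrite oner_eq0.
by rewrite /row_full mxrank_delta => /eqP <-.
Qed.

(** The image of [G] consists of multiples of the commuting [rG h], so it is commutative and Schur's
    lemma makes it scalar. *)
Lemma mx_irr_abelian_quotient_linear (K H : {group gT}) :
    (K * H)%g = G -> abelian H ->
    {in K, forall k, is_scalar_mx (rG k)} -> d = 1%N.
Proof.
move=> KH_G abH scalK; apply: mx_irr_scalar_linear => x Gx.
have sKG : K \subset G by rewrite -KH_G mulG_subl.
have sHG : H \subset G by rewrite -KH_G mulG_subr.
have splitG y : y \in G -> exists a h, h \in H /\ rG y = a *: rG h.
  rewrite -{1}KH_G => /mulsgP[k h Kk Hh ->]; have /is_scalar_mxP[a aE] := scalK k Kk.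
  exists a, h; split=> //.
  by rewrite repr_mxM ?(subsetP sKG k) ?(subsetP sHG h) // aE mul_scalar_mx.
apply: (mx_irr_cent_scalar irrG) => y Gy.
have [a [h [Hh ->]]] := splitG x Gx; have [b [h' [Hh' ->]]] := splitG y Gy.
rewrite -!scalemxAl -!scalemxAr !scalerA mulrC.
have [Gh Gh'] := (subsetP sHG h Hh, subsetP sHG h' Hh').
by rewrite -!repr_mxM // (centsP abH _ Hh _ Hh').
Qed.

End ScalarImage.

(** All coordinates away from [x0] vanish. Since [x0] need not belong to [X], taking [x0 = 0] shows
    that a vector of the span orthogonal to [X] is zero. *)
Lemma span_orthogonal_line (C : numClosedFieldType) m n (X : seq (tpow C m n)) x0 y :
    pairwise_orthogonal (@tdot C m n) X -> y \in <<X>>%VS ->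
    {in X, forall x, x != x0 -> tdot y x = 0} -> y \in <[x0]>%VS.
Proof.
move=> /pairwise_orthogonalP[/= /andP[X0 uniqX] orthX] yX y_x0.
rewrite (coord_span (X := in_tuple X) yX); apply: memv_suml => i _.
have Xi : X`_i \in X by apply: mem_nth.
have [->|xi] := eqVneq X`_i x0; first by rewrite memvZ // memv_line.
suff -> : coord (in_tuple X) i y = 0 by rewrite scale0r mem0v.
have := y_x0 _ Xi xi.
have ujX (j : 'I_(size X)) : j != i -> X`_j != X`_i.
  by move=> ji; rewrite nth_uniq.
rewrite {1}(coord_span (X := in_tuple X) yX) linear_sumlz (bigD1 i) //= big1.
  rewrite addr0 linearZl_LR /= => /eqP; rewrite mulf_eq0 => /orP[/eqP //|].
  have Xi0 : X`_i != 0 by apply: contraNneq X0 => <-.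
  by rewrite gt_eqF // (tdot_gt0 Xi0).
move=> j ji; rewrite linearZl_LR /= orthX ?mulr0 ?ujX //.
by apply: mem_nth.
Qed.

(** * Orthogonal bases of symmetrized tensors *)

(* [gact] is also the name of a group-action predicate in the library. *)
Local Notation gact := Defs.gact.

Section Estar.

Variables (C : numClosedFieldType) (m n : nat) (V : vectType C) (e : n.-tuple V).
Variables (G : {group 'S_m}) (chi : 'S_m -> C).
Hypothesis free_e : free e.

Local Notation star := (estar e G chi).
Local Notation c := (chi 1%g / #|G|%:R).

Lemma gact1 (a : Gamma m n) : gact a 1%g = a.
Proof. by apply/ffunP => i; rewrite ffunE invg1 perm1. Qed.

Lemma gactM (a : Gamma m n) s t : gact a (s * t)%g = gact (gact a s) t.
Proof. by apply/ffunP => i; rewrite !ffunE invMg permM. Qed.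

Lemma gact_eqV (a b : Gamma m n) s : (a == gact b s^-1%g) = (gact a s == b).
Proof.
by apply/eqP/eqP => [->|<-]; rewrite -gactM ?mulVg ?mulgV gact1.
Qed.

Lemma estarE a b : star a b = c * \sum_(s in G) chi s * (gact a s == b)%:R.
Proof.
rewrite /estar /Tsym scale_lfunE sum_lfunE ffunE sum_ffunE; congr (_ * _).
apply: eq_bigr => s _; rewrite scale_lfunE ffunE lfunE /=; congr (_ * _).
by rewrite ffunE etensE // gact_eqV.
Qed.

Lemma tdot_estar a (t : tpow C m n) :
  tdot (star a) t = c * \sum_(s in G) chi s * (t (gact a s))^*.
Proof.
rewrite /tdot; under eq_bigr => b _ do rewrite estarE -(mulrA c) mulr_suml.
rewrite -mulr_sumr exchange_big; congr (_ * _); apply: eq_bigr => s _.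
rewrite (bigD1 (gact a s)) //= eqxx mulr1 big1 ?addr0 // => b.
by rewrite eq_sym => /negPf->; rewrite mulr0 mul0r.
Qed.

Lemma estar_orbit a b : star a b != 0 -> exists2 s, s \in G & gact a s = b.
Proof.
rewrite estarE => nz.
suff /exists_inP[s Gs /eqP sE] : [exists s in G, gact a s == b] by exists s.
apply: contraR nz => /exists_inPn ab; rewrite big1 ?mulr0 // => s Gs.
by rewrite (negPf (ab s Gs)) mulr0.
Qed.

Lemma tdot_estar_orbit a b :
  tdot (star a) (star b) != 0 -> exists2 s, s \in G & b = gact a s.
Proof.
rewrite tdot_estar => nz.
have [s Gs nz_s] : exists2 s, s \in G & star b (gact a s) != 0.
  apply/exists_inP; apply: contraR nz => /exists_inPn b0.
  rewrite big1 ?mulr0 // => s Gs; have := b0 s Gs; rewrite negbK => /eqP->.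
  by rewrite rmorph0 mulr0.
have [t Gt bt] := estar_orbit nz_s.
exists (s * t^-1)%g; first by rewrite groupM ?groupV.
by rewrite gactM -bt -gactM mulgV gact1.
Qed.

Lemma etens_span : <<[seq etens e a | a <- enum (Gamma m n)]>>%VS = fullv.
Proof.
apply/eqP; rewrite eqEsubv subvf /=; apply/subvP => t _.
have -> : t = \sum_a t a *: etens e a.
  apply/ffunP => b; rewrite sum_ffunE (bigD1 b) //= ffunE etensE // eqxx.
  rewrite big1 => [|a /negPf ab]; first by rewrite addr0 /GRing.scale /= mulr1.
  by rewrite ffunE etensE // ab /GRing.scale /= mulr0.
apply: memv_suml => a _; apply/memvZ/memv_span/map_f; exact: mem_enum.
Qed.

Lemma sym_class_span : sym_class n G chi = <<[seq star a | a <- enum (Gamma m n)]>>%VS.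
Proof. by rewrite /sym_class -etens_span limg_span -map_comp. Qed.

(** Greedy choice: a new [star a] not orthogonal to a chosen [star b] has [a] in the orbit of [b],
    hence already lies on its line. *)
Lemma ostar_basis_exists :
    (forall a s, s \in G -> star (gact a s) \in <[star a]>%VS) ->
  exists X : seq (tpow C m n), ostar_basis e G chi X.
Proof.
move=> colin.
suff [X [orthX starX spanX]] : exists X : seq (tpow C m n),
    [/\ pairwise_orthogonal (@tdot C m n) X,
        {in X, forall x, exists a, x = star a} &
        <<X>>%VS = <<[seq star a | a <- enum (Gamma m n)]>>%VS].
  exists X; split=> //; rewrite /basis_of sym_class_span spanX eqxx.
  exact: orthogonal_free orthX.
elim: (enum _) => [|a l [X [orthX starX spanX]]]; first by exists [::].
rewrite /= span_cons -spanX; have [aX|aX] := boolP (star a \in <<X>>%VS).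
  by exists X; split=> //; apply/esym/addv_idPr; rewrite -memvE.
exists (star a :: X); split; last by rewrite span_cons.
  have /andP[X0 orthX'] := orthX; rewrite /pairwise_orthogonal /= inE negb_or X0.
  rewrite orthX' !andbT; apply/andP; split.
    by apply: contraNneq aX => <-; rewrite mem0v.
  apply/allP => x Xx /=; apply: contraR aX => /[dup] nz.
  have [b xE] := starX x Xx; rewrite xE => /tdot_estar_orbit[s Gs bE].
  have aE : a = gact b s^-1%g by rewrite bE -gactM mulgV gact1.
  rewrite aE; have := colin b s^-1%g; rewrite groupV => /(_ Gs).
  by apply: subvP; rewrite -memvE -xE memv_span.
by move=> x; rewrite inE => /predU1P[->|/starX //]; exists a.
Qed.

Lemma estar_linear a s :
    {in G &, {morph chi : x y / (x * y)%g >-> x * y}} -> s \in G ->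
  star (gact a s) \in <[star a]>%VS.
Proof.
move=> chiM Gs; suff -> : star (gact a s) = chi s^-1%g *: star a.
  by rewrite memvZ // memv_line.
apply/ffunP => b; rewrite ffunE !estarE [RHS]mulrCA; congr (_ * _).
rewrite mulr_sumr (reindex_inj (mulgI s^-1%g)) /=.
apply: eq_big => [x|x]; rewrite groupMl ?groupV // => Gx.
by rewrite chiM ?groupV // mulrA -gactM mulKVg.
Qed.

End Estar.

Section Necessity.

Variables (C : numClosedFieldType) (m n : nat) (V : vectType C) (e : n.-tuple V).
Variables (G K H : {group 'S_m}) (d : nat) (rG : mx_representation C G d).
Variables (chi : 'S_m -> C) (alpha : Gamma m n).
Hypotheses (free_e : free e) (irrG : mx_irreducible rG).
Hypothesis chiE : {in G, forall x, chi x = \tr (rG x)}.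
Hypotheses (nKG : (K <| G)%g) (KH_G : (K * H)%g = G).
Hypotheses (abK : abelian K) (abH : abelian H).
Hypothesis alpha_regular : gstab G alpha = 1%g.

Local Notation star := (estar e G chi).
Local Notation c := (chi 1%g / #|G|%:R).
Local Notation f u := (star (gact alpha u)).

Lemma gact_regular s t : s \in G -> t \in G -> gact alpha s = gact alpha t -> s = t.
Proof.
move=> Gs Gt st; have : (s * t^-1)%g \in gstab G alpha.
  by rewrite inE groupM ?groupV //= gactM st -gactM mulgV gact1.
by rewrite alpha_regular => /set1gP/eqP; rewrite -eq_mulgV1 => /eqP.
Qed.

Lemma estar_regular u x : u \in G -> x \in G ->
  f u (gact alpha x) = c * chi (u^-1 * x)%g.
Proof.
move=> Gu Gx; rewrite estarE //; congr (_ * _).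
rewrite (bigD1 (u^-1 * x)%g) ?groupM ?groupV //= -gactM mulKVg eqxx mulr1.
rewrite big1 ?addr0 // => s /andP[Gs su]; rewrite -gactM.
case: eqP => [/gact_regular us|_]; last by rewrite mulr0.
by case/eqP: su; rewrite -us ?groupM // mulKg.
Qed.

Let d0 : d%:R != 0 :> C.
Proof. by rewrite pnatr_eq0 -lt0n (mx_irr_gt0 irrG). Qed.

Let chi1 : chi 1%g = d%:R.
Proof. by rewrite chiE // repr_mx1 mxtrace1. Qed.

(** The convolution of [chi] with itself is [#|G| / d] times [chi], and [chi] at an inverse is the
    conjugate. *)
Lemma tdot_regular u w : u \in G -> w \in G ->
  tdot (f u) (f w) = c * chi (u^-1 * w)%g.
Proof.
move=> Gu Gw; rewrite tdot_estar //; congr (_ * _).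
have Guw : (u^-1 * w)%g \in G by rewrite groupM ?groupV.
have conv : \sum_(x in G) chi x * chi (x^-1 * (u^-1 * w))%g =
    #|G|%:R / d%:R * chi (u^-1 * w)%g.
  have := mx_irr_char_conv irrG (group1 G).
  move/(congr1 (fun B => \tr (B *m rG (u^-1 * w)%g))).
  rewrite -scalemxAl mxtraceZ repr_mx1 mul1mx -chiE // => <-.
  rewrite mulmx_suml raddf_sum; apply: eq_bigr => x Gx /=.
  by rewrite -scalemxAl mxtraceZ mul1g !chiE ?groupM ?groupV // repr_mxM ?groupV.
transitivity (c * \sum_(x in G) chi x * chi (x^-1 * (u^-1 * w))%g); last first.
  rewrite conv chi1; field; rewrite d0 /=.
  by rewrite pnatr_eq0 -lt0n cardG_gt0.
rewrite mulr_sumr; apply: eq_bigr => x Gx.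
have Gwux : (w^-1 * (u * x))%g \in G by rewrite !(groupM, groupV).
rewrite -gactM estar_regular ?groupM // rmorphM mulrCA; congr (_ * (_ * _)).
  by rewrite chi1 fmorph_div !rmorph_nat.
rewrite !chiE // ?groupM ?groupV //=.
rewrite -(abelian_product_char_conj irrG nKG KH_G abK abH Gwux).
by rewrite !invMg invgK !mulgA.
Qed.

Lemma ostar_basis_char_zero (X : seq (tpow C m n)) :
    ostar_basis e G chi X -> d != 1%N ->
  exists2 k, k \in K & chi k = 0.
Proof.
case=> /andP[/eqP spanX _] orthX starX d_neq1.
have sKG : K \subset G := normal_sub nKG.
have sHG : H \subset G by rewrite -KH_G mulG_subr.
suff /exists_inP[k Kk /eqP k0] : [exists k in K, chi k == 0] by exists k.
apply: contraR d_neq1 => /exists_inPn chiK; apply/eqP.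
have splitG x : x \in G -> exists k h, [/\ k \in K, h \in H & x = (k * h)%g].
  by rewrite -{1}KH_G => /mulsgP[k h Kk Hh ->]; exists k, h.
have [_ _ offT] := abelian_product_char irrG nKG KH_G abK abH.
have scalP x : x \in G -> chi x != 0 -> exists k a,
    [/\ k \in K, a != 0 & rG x = a *: rG k].
  move=> /splitG[k [h [Kk Hh ->]]]; have [Gk Gh] := (subsetP sKG k Kk, subsetP sHG h Hh).
  rewrite chiE ?groupM // => nz; have [/is_scalar_mxP[a aE]|off] := offT h Hh; last first.
    by rewrite off // eqxx in nz.
  exists k, a; have kE : rG (k * h)%g = a *: rG k by rewrite repr_mxM // aE mul_mx_scalar.
  by split=> //; apply: contraNneq nz => a0; rewrite kE a0 scale0r mxtrace0.
have c0 : c != 0.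
  by rewrite chi1 mulf_neq0 // invr_eq0 pnatr_eq0 -lt0n cardG_gt0.
have f_in u : f u \in <<X>>%VS.
  by rewrite spanX (sym_class_span _ _ free_e) memv_span // map_f // mem_enum.
have tdot_f u x : u \in G -> x \in X -> tdot (f u) x != 0 ->
    exists s, [/\ s \in G, x = f s & chi (u^-1 * s)%g != 0].
  move=> Gu Xx nz; have [b xE] := starX x Xx.
  move: (nz); rewrite xE => /tdot_estar_orbit -/(_ free_e)[s Gs bE].
  have xf : x = f (u * s)%g by rewrite xE bE gactM.
  exists (u * s)%g; split; [by rewrite groupM | by rewrite -xE | ].
  by move: nz; rewrite xf tdot_regular ?groupM // mulf_eq0 negb_or => /andP[].
have f1_neq0 : f 1%g != 0.
  apply/eqP => f10; have := tdot_regular (group1 G) (group1 G).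
  rewrite f10 linear0l invg1 mulg1 => /esym/eqP.
  by rewrite mulf_eq0 (negPf c0) chi1 (negPf d0).
have [x0 Xx0 nz0] : exists2 x0, x0 \in X & tdot (f 1%g) x0 != 0.
  apply/hasP; apply: contraR f1_neq0 => /hasPn f1X.
  have f1_orth : {in X, forall x, x != 0 -> tdot (f 1%g) x = 0}.
    by move=> x Xx _; apply/eqP; rewrite -[_ == _]negbK; apply: f1X.
  have /vlineP[b ->] := span_orthogonal_line orthX (f_in _) f1_orth.
  by rewrite scaler0.
have [s0 [Gs0 x0E chi_s0]] := tdot_f _ _ (group1 G) Xx0 nz0.
have [k0 [a0 [Kk0 a0_neq0 s0V]]] : exists k a,
    [/\ k \in K, a != 0 & rG s0^-1%g = a *: rG k].
  apply: scalP; rewrite ?groupV // chiE ?groupV //.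
  rewrite (abelian_product_char_conj irrG nKG KH_G abK abH Gs0) conjC_eq0 -chiE //.
  by rewrite invg1 mul1g in chi_s0.
(* If [f k] were not orthogonal to another [x = f s] of [X], then [s0^-1 s = s0^-1 k (k^-1 s)] would
   act as a nonzero multiple of some element of [rG K], so [chi (s0^-1 s) != 0], against the
   orthogonality of [x0] and [x]. *)
have line k : k \in K -> f k \in <[x0]>%VS.
  move=> Kk; have Gk := subsetP sKG k Kk.
  apply: (span_orthogonal_line orthX (f_in k)) => x Xx xx0; apply/eqP.
  rewrite -[_ == _]negbK; apply/negP => /(tdot_f _ _ Gk Xx)[s [Gs xE chi_s]].
  have Gks : (k^-1 * s)%g \in G by rewrite groupM ?groupV.
  have [k1 [a1 [Kk1 a1_neq0 ksE]]] := scalP _ Gks chi_s.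
  have [_ orth] := pairwise_orthogonalP orthX.
  have x0x : x0 != x by rewrite eq_sym.
  have /eqP : tdot x0 x = 0 := orth _ _ Xx0 Xx x0x.
  rewrite x0E xE tdot_regular // mulf_eq0 (negPf c0) /=.
  have [Gk0 Gk1] := (subsetP sKG _ Kk0, subsetP sKG _ Kk1).
  have -> : chi (s0^-1 * s)%g = a0 * a1 * chi (k0 * (k * k1))%g.
    rewrite !chiE ?groupM ?groupV // -mxtraceZ; congr (\tr _).
    have -> : (s0^-1 * s = s0^-1 * (k * (k^-1 * s)))%g by rewrite mulKVg.
    rewrite (repr_mxM rG (groupVr Gs0) (groupM Gk Gks)) (repr_mxM rG Gk Gks) ksE s0V.
    rewrite (repr_mxM rG Gk0 (groupM Gk Gk1)) (repr_mxM rG Gk Gk1).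
    by rewrite -!scalemxAl -!scalemxAr scalerA.
  by rewrite !mulf_eq0 (negPf a0_neq0) (negPf a1_neq0) /= (negPf (chiK _ _)) // !groupM.
apply: (mx_irr_abelian_quotient_linear irrG KH_G abH) => k Kk.
have Gk := subsetP sKG k Kk.
have /vlineP[b1 f1E] := line _ (group1 K).
have /vlineP[b fkE] := line _ (groupVr Kk).
have b1_neq0 : b1 != 0 by apply: contraNneq f1_neq0 => b10; rewrite f1E b10 scale0r.
(* Collinearity of [f k^-1] and [f 1], read at the coordinate of [alpha x], compares [chi (k x)]
   with [chi x]. *)
apply: (char_translate_scalar irrG (c := b / b1) Gk) => x Gx.
have fkE1 : f k^-1%g = (b / b1) *: f 1%g by rewrite f1E fkE scalerA divfK.
have := congr1 (fun t : tpow C m n => t (gact alpha x)) fkE1.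
rewrite ffunE !estar_regular ?groupV // invgK invg1 mul1g -!chiE ?groupM //.
by rewrite /GRing.scale /= mulrCA => /(mulfI c0).
Qed.

End Necessity.

(** * The base group and the top group of a wreath product *)

Section WreathSubgroups.

Variables (A H : finGroupType) (Omega : finType) (to : {action H &-> Omega}).
Hypotheses (abelA : abelian [set: A]) (abelH : abelian [set: H]).

Local Notation W := (wreath A to).
Local Notation Wr k h := (Wreath (A := A) to (k, h)).

Definition wreath_base : {set W} := [set u : W | (wreath_val u).2 == 1%g].
Definition wreath_top : {set W} := [set u : W | (wreath_val u).1 == 1%g].

Lemma wreath_mulE k1 h1 k2 h2 :
  (Wr k1 h1 * Wr k2 h2)%g = Wr (k1 * wreath_phi to h1 k2)%g (h1 * h2)%g.
Proof. by []. Qed.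

Lemma wreath_phi_one (h : H) : wreath_phi (A := A) to h 1%g = 1%g.
Proof. by apply/ffunP => x; rewrite ffunE !oneg_ffun. Qed.

Fact wreath_base_group_set : group_set wreath_base.
Proof.
apply/group_setP; split=> [|[[k1 h1]] [[k2 h2]]]; first by rewrite inE.
by rewrite !inE /= => /eqP-> /eqP->; rewrite mulg1.
Qed.
Canonical wreath_base_group := Group wreath_base_group_set.

Fact wreath_top_group_set : group_set wreath_top.
Proof.
apply/group_setP; split=> [|[[k1 h1]] [[k2 h2]]]; first by rewrite inE.
by rewrite !inE /= => /eqP-> /eqP->; rewrite wreath_phi_one mulg1.
Qed.
Canonical wreath_top_group := Group wreath_top_group_set.

Lemma wreath_base_normal : (wreath_base <| [set: W])%g.
Proof.
apply/fingroup.normalP; split=> [|[[k h]] _]; first exact: subsetT.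
apply/eqP; rewrite eqEcard cardJg leqnn andbT; apply/subsetP => x /imsetP[[[k1 h1]]].
rewrite inE => /= /eqP-> ->; rewrite inE /=.
by rewrite !mul1g mulVg.
Qed.

Lemma wreath_base_top : (wreath_base * wreath_top)%g = [set: W].
Proof.
apply/setP => -[[k h]]; rewrite inE; apply/mulsgP.
exists (Wr k 1%g) (Wr 1%g h); rewrite ?inE //= wreath_mulE.
by rewrite wreath_phi_one mulg1 mul1g.
Qed.

Lemma wreath_base_abelian : abelian wreath_base.
Proof.
apply/centsP => -[[k1 h1]]; rewrite inE => /= /eqP-> [[k2 h2]]; rewrite inE => /= /eqP->.
rewrite /commute !wreath_mulE !wreath_phi1; congr (Wr _ _).
by apply/ffunP => x; rewrite !mulg_ffun; apply: (centsP abelA); rewrite inE.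
Qed.

Lemma wreath_top_abelian : abelian wreath_top.
Proof.
apply/centsP => -[[k1 h1]]; rewrite inE => /= /eqP-> [[k2 h2]]; rewrite inE => /= /eqP->.
rewrite /commute !wreath_mulE !wreath_phi_one; congr (Wr _ _).
by apply: (centsP abelH); rewrite inE.
Qed.

Lemma card_wreath_top : #|wreath_top| = #|H|.
Proof.
rewrite -(card_imset (f := fun h : H => Wr 1%g h)); last by move=> h1 h2 [].
apply: eq_card => -[[k h]]; rewrite inE /=.
by apply/eqP/imsetP => [->|[h' _ [->]] //]; exists h.
Qed.

Lemma wreath_base_exponent : {in wreath_base, forall u, (u ^+ #|A| = 1)%g}.
Proof.
move=> [[k h]]; rewrite inE => /= /eqP->.
have expE n : (Wr k 1 ^+ n = Wr (k ^+ n) 1)%g.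
  elim: n => // n IHn; rewrite !expgS IHn wreath_mulE wreath_phi1.
  by rewrite mulg1.
rewrite expE; congr (Wr _ _); apply/ffunP => x.
have -> n : (k ^+ n)%g x = (k x ^+ n)%g.
  by elim: n => [|n IHn]; rewrite ?oneg_ffun // !expgS mulg_ffun IHn.
by rewrite oneg_ffun -cardsT (expg_cardG (G := [group of [set: A]])) ?inE.
Qed.

End WreathSubgroups.

Theorem corollary4p2 (R : realType) (A H : finGroupType) (Omega : finType)
    (to : {action H &-> Omega})
    (abelA : abelian [set: A]) (abelH : abelian [set: H])
    (m n : nat) (G : {group 'S_m}) (isoG : G \isog [set: wreath A to])
    (V : vectType R[i]) (dot : {dot V for Num.conj})
    (dimV : \dim {:V} = n) (n_gt1 : (1 < n)%N)
    (e : n.-tuple V) (basis_e : basis_of {:V} e)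
    (orthonormal_e : orthonormal dot e)
    (chi : 'S_m -> R[i]) (irr_chi : is_irr_char G chi)
    (regular_alpha : exists alpha : Gamma m n, gstab G alpha = 1%g)
    (card_H : ~ nat_span (primes #|A|) #|H|) :
  (exists X : seq (tpow R[i] m n), ostar_basis e G chi X) <-> chi 1%g = 1.
Proof.
have free_e := basis_free basis_e.
have [d [rG [irrG chiE]]] := irr_chi.
have chi1 : chi 1%g = d%:R by rewrite chiE // repr_mx1 mxtrace1.
have [alpha alphaP] := regular_alpha.
split=> [[X ostarX]|]; last first.
  rewrite chi1 => /eqP; rewrite pnatr_eq1 => /eqP d1; subst d.
  apply: (ostar_basis_exists free_e) => a s Gs.
  apply: (estar_linear free_e _ _ Gs) => x y Gx Gy.
  rewrite !chiE ?groupM // repr_mxM // (mx11_scalar (rG x)) (mx11_scalar (rG y)).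
  by rewrite -scalar_mxM !mxtrace_scalar.
have [f injf fW] : exists2 f : {morphism [set: wreath A to] >-> 'S_m},
    ('injm f)%g & (f @* [set: wreath A to])%g = G.
  by apply/isogP; rewrite isog_sym.
pose K := (f @* wreath_base_group A to)%G; pose L := (f @* wreath_top_group A to)%G.
have nKG : (K <| G)%g by rewrite -fW morphim_normal // wreath_base_normal.
have KL_G : (K * L)%g = G by rewrite -morphimMl ?subsetT // wreath_base_top.
have abK : abelian K by rewrite morphim_abelian // wreath_base_abelian.
have abL : abelian L by rewrite morphim_abelian // wreath_top_abelian.
have [d1|d_neq1] := eqVneq d 1%N; first by rewrite chi1 d1.
have [k Kk chik] := ostar_basis_char_zero free_e irrG chiE nKG KL_G abK abL alphaP ostarX d_neq1.
have [d_dv [s sP] _] := abelian_product_char irrG nKG KL_G abK abL.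
have cardL : #|L| = #|H| by rewrite card_injm ?subsetT // card_wreath_top.
(* As [d] divides [#|H|], it suffices to place [d] in the span. *)
case: card_H; rewrite -cardL; have [b ->] := dvdnP d_dv; apply: nat_spanMl.
have [trk sk] := sP k Kk.
have A_gt0 : (0 < #|A|)%N by apply/card_gt0P; exists 1%g.
apply: (@lam_leung _ _ _ (fun j => s j k) A_gt0) => [j|]; last first.
  by rewrite -trk -chiE // (subsetP (normal_sub nKG)).
have [sk1 _] := sk j.
(* The base group has exponent dividing [#|A|], so the [s j k] are [#|A|]-th roots of unity. *)
suff /dvdnP[q ->] : (#[k]%g %| #|A|)%N by rewrite mulnC exprM sk1 expr1n.
have /morphimP[u _ Ku ->] := Kk.
by rewrite order_dvdn -morphX ?inE // wreath_base_exponent // morph1.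
Qed.
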